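(* Let $T>0$, $\gamma>0$, $\beta\in(0,1]$, and let $X=(X_t,\mathcal G(I),\mathbb P_{r,\mu})$ be the superprocess with one-particle motion $Z$, $K(ds)=\gamma\,ds$ and $\psi(s,y,\xi)=\xi^{1+\beta}$. Let $J_A$ be the $J$-functional of $X$ associated with $A\in\mathcal A_T^1$. Then, for $k\ge0$, $0\le r<T$ and $z\in S$, $$-\log\mathbb E_{r,\delta_z}\bigl[e^{-J_A-k\langle1,X_T\rangle}\bigr]\le E_{r,z}\bigl[A[r,T]\bigr]+\frac{k}{\bigl(1+\gamma\beta(T-r)k^\beta\bigr)^{1/\beta}}$$ and $$-\log\mathbb E_{r,\delta_z}\bigl[e^{-J_A}\mathbf 1_{\{X_T=0\}}\bigr]\le E_{r,z}\bigl[A[r,T]\bigr]+\frac1{\bigl(\gamma\beta(T-r)\bigr)^{1/\beta}}.$$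
   Context: Markov process: $Z=(Z_t,\mathcal F(I),P_{r,z})$ is a time-inhomogeneous right (Markov) process with sample space $(\Omega,\mathcal F)$ and state space $(S,\mathcal B)$, where $S$ is a metrizable Luzin space with Borel field $\mathcal B$. The $\sigma$-algebra $\mathcal F(I)\subset\mathcal F$ contains the events observable during the time interval $I\subset[0,\infty)$. $P_{r,\mu}$ is the measure under which $Z$ starts at time $r\ge0$ with initial distribution $\mu$; $P_{r,z}=P_{r,\delta_z}$. ''Right process'' means that $t\mapsto Z_t(\omega)$ is càdlàg and that for $r<t$, measurable $f:S\to\mathbb R_+$ and probability measures $\mu$, the process $s\mapsto E_{s,Z_s}[f(Z_t)]$ is $P_{r,\mu}$-a.s. right-continuous on $[r,t)$. Additive functionals: a nonnegative additive functional $A$ of $Z$ is a random measure $A(dt)$ on $[0,\infty)$ such that $A(I)$ depends only on events in (the completion of) $\mathcal F(I)$ for every interval $I$. $\mathcal A_{(1)}$: those of the form $A[s,u]=\sum_{s\le t_i\le u}f_i(Z_{t_i})$ with finitely many times $t_1<\dots<t_n$ and bounded measurable $f_i\ge0$. $\mathcal A_{(2)}$: those $A$ for which there are $A_n\in\mathcal A_{(1)}$ with $A_n[r,\infty)\to A[r,\infty)$ $P_{r,z}$-a.s. for all $(r,z)$, with $A_n[T',\infty)=0$ for all $n$ for some $T'>0$, and $\sup_{\omega,n}A_n[0,T'](\omega)<\infty$. $\mathcal A$: all nonnegative additive functionals $A$ for which there are $A_n\in\mathcal A_{(2)}$ with $A_n(B)\nearrow A(B)$ for all measurable $B\subset\mathbb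 R_+$. $\mathcal A_T^1:=\{A\in\mathcal A: E_{r,z}[A[r,T]]<\infty$ and $A(T,\infty)=0$ $P_{r,z}$-a.s. for all $(r,z)\in[0,T]\times S\}$. Superprocess: with $\langle f,\nu\rangle=\int f\,d\nu$, $X$ is the time-inhomogeneous Markov process on the space $\mathcal M$ of finite nonnegative Borel measures on $S$ with $\mathbb E_{r,\mu}[e^{-\langle f,X_t\rangle}]=e^{-\langle u(r,\cdot),\mu\rangle}$ for bounded measurable $f\ge0$ and $r\le t$, where $u$ is the unique nonnegative solution of $u(s,y)=E_{s,y}[f(Z_t)]-\gamma E_{s,y}[\int_s^t u(\tau,Z_\tau)^{1+\beta}\,d\tau]$, $r\le s\le t$. Convention: $X_t=0$ $\mathbb P_{r,\mu}$-a.s. for $t<r$. $\{X_T=0\}$ is the event that $X_T$ is the zero measure. $J$-functionals: for $A\in\mathcal A_{(1)}$ given by $A[s,u]=\sum_{s\le t_i\le u}f_i(Z_{t_i})$ with finitely many times $t_1<\dots<t_n$ and bounded measurable $f_i\ge0$, $J_A:=\sum_i\langle f_i,X_{t_i}\rangle$; for general $A\in\mathcal A$, $J_A$ is obtained by passing to the limit along approximating sequences as in the definitions of $\mathcal A_{(2)}$ and $\mathcal A$ (Dynkin). $J_A$ is additive in $A$; for $A\in\mathcal A_T^1$ one has $\mathbb E_{r,\mu}[e^{-J_A}]=e^{-\langle v(r,\cdot),\mu\rangle}$, where $v$ solves $v(r,y)=E_{r,y}[A[r,T]]-\gamma E_{r,y}[\int_r^T v(s,Z_s)^{1+\beta}\,ds]$,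 $0\le r\le T$. In particular $J_A+k\langle1,X_T\rangle$ is the $J$-functional of $A+k\delta_T$. *)

(* Defs.v *)
From HB Require Import structures.
From mathcomp Require Import all_boot all_order all_algebra.
From mathcomp Require Import all_classical all_reals all_analysis.
From mathcomp Require Import measurable_realfun.

Set Implicit Arguments.
Unset Strict Implicit.
Unset Printing Implicit Defensive.

Import Order.TTheory GRing.Theory Num.Theory.
Import numFieldNormedType.Exports.

Local Open Scope classical_set_scope.
Local Open Scope ring_scope.
Local Open Scope ereal_scope.

Definition borel (S : ptopologicalType) := g_sigma_algebraType (@open S).

(* A metrizable Luzin space is a space homeomorphic to a Borel subset of a
   compact metrizable space (Dellacherie--Meyer, III.16). *)
Definition metrizable_luzin (R : realType) (S : topologicalType) : Prop :=
  exists (K : metricType R) (h : S -> K),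
    [/\ compact [set: K],
        injective h,
        forall U : set S, open U <-> exists2 V : set K, open V & U = h @^-1` V &
        <<s @open K >> (range h)].

Section finite_measures.
Context d (E : measurableType d) (R : realType).

Definition finmeas : Type := {finite_measure set E -> \bar R}.

HB.instance Definition _ := gen_eqMixin finmeas.
HB.instance Definition _ := gen_choiceMixin finmeas.
HB.instance Definition _ := isPointed.Build finmeas mzero.

Definition finmeas_measurable : set (set finmeas) :=
  <<s [set (fun mu : finmeas => mu B) @^-1` V |
         B in measurable & V in measurable] >>.

Definition finmeas_display : measure_display.
Proof. by constructor. Qed.

Let finmeas_measurable0 : finmeas_measurable set0.
Proof. exact: sigma_algebra0. Qed.

Let finmeas_measurableC U :
  finmeas_measurable U -> finmeas_measurable (~` U).
Proof. exact: sigma_algebraC. Qed.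

Let finmeas_measurableU (F : (set finmeas)^nat) :
  (forall i, finmeas_measurable (F i)) -> finmeas_measurable (\bigcup_i F i).
Proof. exact: sigma_algebra_bigcup. Qed.

HB.instance Definition _ := @isMeasurable.Build finmeas_display finmeas
  finmeas_measurable finmeas_measurable0 finmeas_measurableC
  finmeas_measurableU.

End finite_measures.

(* A time-inhomogeneous Markov process.  Time is [0, +oo[, so fields at
   negative times carry no information.  [events I] is the sigma-algebra F(I)
   of the events observable during I; it may be larger than the one generated
   by the [coord t] with t in I.  [law r x] is P_{r,x}, a probability on the
   whole sample space. *)
Record markov_process (R : realType) d (E : measurableType d) :=
  MarkovProcess {
  sample_display : measure_display ;
  sample : measurableType sample_display ;
  coord :> R -> sample -> E ;
  events : interval R -> set (set sample) ;
  law : R -> R.-pker E ~> sample ;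
  events_sigma_algebra : forall I : interval R,
    [set` I] `<=` `[0%R, +oo[ -> sigma_algebra [set: sample] (events I) ;
  events_measurable : forall I : interval R,
    [set` I] `<=` `[0%R, +oo[ -> events I `<=` measurable ;
  events_mono : forall I J : interval R,
    [set` I] `<=` [set` J] -> [set` J] `<=` `[0%R, +oo[ ->
    events I `<=` events J ;
  events_coord : forall (I : interval R) (t : R) (B : set E),
    [set` I] `<=` `[0%R, +oo[ -> t \in I -> measurable B ->
    events I (coord t @^-1` B) ;
  law_start : forall (r : R) (x : E) (B : set E),
    (0 <= r)%R -> measurable B -> law r x (coord r @^-1` B) = \d_x B ;
  markov_property : forall (r t : R) (x : E) (C D : set sample),
    (0 <= r)%R -> (r <= t)%R -> events `[r, t] C -> events `[t, +oo[ D ->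
    law r x (C `&` D) = \int[law r x]_(w in C) law t (coord t w) D }.

Arguments sample {R d E} _.
Arguments coord {R d E} _ _ _.
Arguments events {R d E} _ _ _.
Arguments law {R d E} _ _.

(* P_{r,mu} for an initial distribution mu *)
Definition law_init (R : realType) d (E : measurableType d)
    (Z : markov_process R E) (r : R) (mu : probability E R) (B : set (sample Z))
  : \bar R := \int[mu]_x law Z r x B.
Arguments law_init {R d E} Z r mu B.

Definition right_process (R : realType) (S : ptopologicalType)
    (Z : markov_process R (borel S)) : Prop :=
  [/\ forall (w : sample Z) (t : R), (0 <= t)%R ->
        (fun s => Z s w : S) @ t^'+ --> (Z t w : S),
      forall (w : sample Z) (t : R), (0 < t)%R ->
        exists l : S, (fun s => Z s w : S) @ t^'- --> l &
      forall (r t : R) (f : borel S -> R) (mu : probability (borel S) R),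
        (0 <= r)%R -> (r < t)%R ->
        measurable_fun [set: borel S] f -> (forall y, 0 <= f y)%R ->
        {ae law_init Z r mu, forall w, forall s : R, (r <= s)%R -> (s < t)%R ->
          (fun q => \int[law Z q (Z q w)]_w' (f (Z t w'))%:E) @ s^'+
            --> \int[law Z s (Z s w)]_w' (f (Z t w'))%:E} ].

Definition bounded_pos_measurable (R : realType) d (E : measurableType d)
    (f : E -> R) : Prop :=
  [/\ measurable_fun [set: E] f, forall y, (0 <= f y)%R &
      exists M : R, forall y, (f y <= M)%R].

Section additive_functionals.
Context (R : realType) (S : ptopologicalType) (Z : markov_process R (borel S)).

(* The completion of F(I) for all the laws P_{r,z} with r before I. *)
Definition completed_events (I : interval R) : set (set (sample Z)) :=
  [set D | forall (r : R) (z : S), (0 <= r)%R -> [set` I] `<=` `[r, +oo[ ->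
     exists D1 D2, [/\ events Z I D1, events Z I D2, D1 `<=` D, D `<=` D2 &
                       law Z r z (D2 `\` D1) = 0]].

(* A random measure on [0, +oo[ is a measure on R that does not charge the
   negative times.  It need not be finite. *)
Definition additive_functional (A : sample Z -> {measure set R -> \bar R})
  : Prop :=
  (forall w, A w `]-oo, 0%R[%classic = 0) /\
  (forall I : interval R, [set` I] `<=` `[0%R, +oo[ ->
   forall V : set (\bar R), measurable V ->
   completed_events I ((fun w => A w [set` I]) @^-1` V)).

Definition atomic_at (A : sample Z -> {measure set R -> \bar R})
    (n : nat) (t : 'I_n -> R) (f : 'I_n -> borel S -> R) : Prop :=
  [/\ forall i, (0 <= t i)%R,
      forall i j : 'I_n, (i < j)%N -> (t i < t j)%R,
      forall i, bounded_pos_measurable (f i) &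
      forall (w : sample Z) (s u : R), (0 <= s)%R -> (s <= u)%R ->
        A w `[s, u]%classic = \sum_(i < n | (s <= t i <= u)%R) (f i (Z (t i) w))%:E].

Definition class1 (A : sample Z -> {measure set R -> \bar R}) : Prop :=
  additive_functional A /\ exists n t f, @atomic_at A n t f.

Definition approx2 (A : sample Z -> {measure set R -> \bar R})
    (A_ : nat -> sample Z -> {measure set R -> \bar R}) : Prop :=
  [/\ forall n, class1 (A_ n),
      forall (r : R) (z : S), (0 <= r)%R ->
        {ae law Z r z, forall w,
          A_ n w `[r, +oo[%classic @[n --> \oo] --> A w `[r, +oo[%classic} &
      exists T' : R, [/\ (0 < T')%R,
        forall n w, A_ n w `[T', +oo[%classic = 0 &
        exists M : R, forall n w, A_ n w `[0%R, T']%classic <= M%:E]].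

Definition class2 (A : sample Z -> {measure set R -> \bar R}) : Prop :=
  additive_functional A /\ exists A_, approx2 A A_.

Definition approx (A : sample Z -> {measure set R -> \bar R})
    (A_ : nat -> sample Z -> {measure set R -> \bar R}) : Prop :=
  (forall n, class2 (A_ n)) /\
  (forall (w : sample Z) (B : set R), measurable B -> B `<=` `[0%R, +oo[ ->
     nondecreasing_seq (fun n => A_ n w B) /\
     A_ n w B @[n --> \oo] --> A w B).

Definition classA (A : sample Z -> {measure set R -> \bar R}) : Prop :=
  additive_functional A /\ exists A_, approx A A_.

(* [A w `[r, T]%classic] is measurable only for the completed sigma-algebra; the
   library integral of a nonnegative function, being a supremum over the simple
   functions below it, is then the integral for the completed law. *)
Definition classA1 (T : R) (A : sample Z -> {measure set R -> \bar R}) : Prop :=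
  classA A /\
  forall (r : R) (z : S), (0 <= r <= T)%R ->
    \int[law Z r z]_w A w `[r, T]%classic < +oo /\
    {ae law Z r z, forall w, A w `]T, +oo[%classic = 0}.

End additive_functionals.

Section superprocesses.
Context (R : realType) (S : ptopologicalType) (Z : markov_process R (borel S)).

Definition log_laplace_solution (gamma beta : R) (f : borel S -> R) (r t : R)
    (u : R -> borel S -> R) : Prop :=
  [/\ measurable_fun ([set` `[r, t]] `*` [set: borel S])
        (fun p : R * borel S => u p.1 p.2),
      forall s y, s \in `[r, t] -> (0 <= u s y)%R &
      forall s y, s \in `[r, t] ->
        (u s y)%:E = \int[law Z s y]_w (f (Z t w))%:E -
          gamma%:E * \int[law Z s y]_w \int[lebesgue_measure]_(q in `[s, t])
            (u q (Z q w) `^ (1 + beta))%:E].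

Definition pairing (f : borel S -> R) (nu : finmeas (borel S) R) : \bar R :=
  \int[nu]_y (f y)%:E.

(* On non-measurable sets the values of a measure are arbitrary. *)
Definition zero_measure (nu : finmeas (borel S) R) : Prop :=
  forall B, measurable B -> nu B = 0.

(* The superprocess with one-particle motion Z, K(ds) = gamma ds and
   psi(s, y, xi) = xi ^ (1 + beta). *)
Definition superprocess (gamma beta : R)
    (X : markov_process R (finmeas (borel S) R)) : Prop :=
  (forall (r t : R) (mu : finmeas (borel S) R), (0 <= t)%R -> (t < r)%R ->
     {ae law X r mu, forall w, zero_measure (X t w)}) /\
  (forall (f : borel S -> R) (r t : R),
     bounded_pos_measurable f -> (0 <= r)%R -> (r <= t)%R ->
     exists u : R -> borel S -> R,
       [/\ log_laplace_solution gamma beta f r t u,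
           forall u', log_laplace_solution gamma beta f r t u' ->
             forall s y, s \in `[r, t] -> u' s y = u s y &
           forall mu : finmeas (borel S) R,
             \int[law X r mu]_w expeR (- pairing f (X t w)) =
             expeR (- pairing (u r) mu)]).

(* [Jversion* X r mu A J]: the random variable J is, under P_{r,mu}, a version
   of the J-functional of A.  J-functionals are only defined up to null sets,
   so the law is part of the definition. *)
Variable X : markov_process R (finmeas (borel S) R).

Definition Jversion1 (r : R) (mu : finmeas (borel S) R)
    (A : sample Z -> {measure set R -> \bar R}) (J : sample X -> \bar R) : Prop :=
  [/\ measurable_fun [set: sample X] J,
      additive_functional A &
      exists n t f, @atomic_at _ _ Z A n t f /\
        {ae law X r mu, forall w, J w = \sum_(i < n) pairing (f i) (X (t i) w)}].

(* The limit is taken in P_{r,mu}-probability. *)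
Definition Jversion2 (r : R) (mu : finmeas (borel S) R)
    (A : sample Z -> {measure set R -> \bar R}) (J : sample X -> \bar R) : Prop :=
  [/\ measurable_fun [set: sample X] J,
      additive_functional A &
      exists A_ J_, [/\ approx2 A A_,
        forall n, Jversion1 r mu (A_ n) (J_ n) &
        forall e : R, (0 < e)%R ->
          law X r mu [set w | e%:E <= `|J_ n w - J w|] @[n --> \oo] --> 0]].

Definition Jversion (r : R) (mu : finmeas (borel S) R)
    (A : sample Z -> {measure set R -> \bar R}) (J : sample X -> \bar R) : Prop :=
  [/\ measurable_fun [set: sample X] J,
      additive_functional A &
      exists A_ J_, [/\ approx A A_,
        forall n, Jversion2 r mu (A_ n) (J_ n) &
        {ae law X r mu, forall w, J_ n w @[n --> \oo] --> J w}]].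

End superprocesses.

(* Main.v *)
Require Import Defs.
From mathcomp Require Import finmap.
From mathcomp Require Import all_boot all_order all_algebra.
From mathcomp Require Import all_classical all_reals all_analysis.
From mathcomp Require Import measurable_realfun.
From mathcomp Require Import ring lra.

Set Implicit Arguments.
Unset Strict Implicit.
Unset Printing Implicit Defensive.

Import Order.TTheory GRing.Theory Num.Theory.
Import numFieldNormedType.Exports.

Local Open Scope classical_set_scope.
Local Open Scope ring_scope.
Local Open Scope ereal_scope.

(** The log-Laplace exponent v of J_A + k <1, X_T> satisfies
      v(r, y) = E_{r,y}[A[r, T]] + k - gamma E_{r,y}[int v(s, Z_s)^(1+beta) ds],
    and without A the solution is the explicit function of T - r
      k / (1 + gamma beta (T - r) k^beta)^(1/beta),
    called [mass_exponent] below.  Adding A can only increase the exponent, so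
    the nonlinear term subtracted from v is at least the one subtracted from
    [mass_exponent]; the difference of the two equations gives
      v(r, z) <= E_{r,z}[A[r, T]] + mass_exponent k (T - r).

    Only one-time functionals have an equation at the outset, so the
    comparison is made there ([log_laplace_solution_shift_le]), where the
    monotonicity of v comes from its representation as minus the logarithm of a
    Laplace transform.  For a functional with finitely many atoms the comparison
    is iterated backwards in time ([atoms_exponent_le]): the Markov property of
    the superprocess ([markov_fun]) replaces the future by its exponent, the
    Markov property of the one-particle motion adds up the means, and the flow
    property of [mass_exponent] lets the constants add up.

    General functionals are reached by the two limits that define them.  What has
    to be preserved is a lower bound of a Laplace transform.  The first limit
    holds in probability and the masses are uniformly bounded
    ([Jversion2_laplace_ge]); the second is increasing in A and almost sure for J
    ([Jversion_laplace_ge]).  The bound for extinction follows by letting k tend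
    to infinity ([Jversion_extinction_ge]), since [mass_exponent k s] stays below
    1 / (gamma beta s)^(1/beta). *)

(** * Integration without measurability, and induction on measurable functions *)

Section integration.
Context d (T : measurableType d) (R : realType).
Implicit Types f g : T -> \bar R.

Import HBNNSimple.

(** Functional form of the monotone class argument.  It is stated for an
    arbitrary predicate because the Markov property has to be extended from
    events to functions twice, once in the past and once in the future. *)
Lemma ge0_measurable_ind (P : (T -> \bar R) -> Prop) :
  (forall D, measurable D -> P (fun x => (\1_D x)%:E)) ->
  (forall (a : R) f, (0 <= a)%R -> measurable_fun setT f ->
     (forall x, 0 <= f x) -> P f -> P (fun x => a%:E * f x)) ->
  (forall f g, measurable_fun setT f -> measurable_fun setT g ->
     (forall x, 0 <= f x) -> (forall x, 0 <= g x) ->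
     P f -> P g -> P (fun x => f x + g x)) ->
  (forall (f_ : (T -> \bar R)^nat) f, (forall n, measurable_fun setT (f_ n)) ->
     (forall n x, 0 <= f_ n x) ->
     (forall x, nondecreasing_seq (f_ ^~ x)) ->
     (forall x, f_ ^~ x @ \oo --> f x) -> (forall n, P (f_ n)) -> P f) ->
  forall f, measurable_fun setT f -> (forall x, 0 <= f x) -> P f.
Proof.
move=> Pind PZ PD Plim f mf f0.
have Pnn (h : {nnsfun T >-> R}) : P (fun x => (h x)%:E).
  pose q (y : R) x := (Num.max y 0 * \1_(h @^-1` [set y]) x)%:E.
  have mq y : measurable_fun setT (q y).
    apply/measurable_EFinP/measurable_funM => //.
  have q0 y x : 0 <= q y x.
    by rewrite lee_fin mulr_ge0// le_max lexx orbT.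
  rewrite (_ : (fun x => (h x)%:E) =
     fun x => \sum_(y <- fset_set (range h)) q y x); last first.
    apply/funext => x; rewrite (fimfunE h x) fsbig_finite//= sumEFin.
    congr EFin; rewrite !big_seq; apply: eq_bigr => y.
    rewrite in_fset_set// => /set_mem[z _ <-].
    by rewrite max_l.
  elim: (fset_set _ : seq _) => [|y s IH].
    under eq_fun do rewrite big_nil.
    rewrite (_ : (fun=> _) = fun x => 0%:E * (\1_[set: T] x)%:E); last first.
      by apply/funext => x; rewrite mul0e.
    apply: PZ => //; last exact: Pind.
      exact/measurable_EFinP/measurable_indic.
  under eq_fun do rewrite big_cons.
  apply: PD => //.
  - exact: emeasurable_sum.
  - by move=> x; exact: sume_ge0.
  - rewrite (_ : q y =
        fun x => (Num.max y 0)%:E * (\1_(h @^-1` [set y]) x)%:E)//.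
    apply: PZ; rewrite ?le_max ?lexx ?orbT//; last exact: Pind.
    exact/measurable_EFinP/measurable_indic.
apply: (Plim (fun n x => (nnsfun_approx measurableT mf n x)%:E)) => //.
- by move=> n; apply/measurable_EFinP.
- by move=> n x; rewrite lee_fin.
- move=> x m n mn; rewrite lee_fin.
  by have /lefP := nd_nnsfun_approx measurableT mf mn; exact.
- by move=> x; apply: cvg_nnsfun_approx.
Qed.

(** The integral of a nonnegative function is a supremum over the simple
    functions below it, so it is monotone for all functions.  This matters for
    the integral over paths in the log-Laplace equation and for the mass that an
    additive functional gives to an interval, whose measurability is not
    available for the uncompleted sigma-algebra. *)
Lemma le_ge0_integral (mu : {measure set T -> \bar R}) (D : set T) f g :
  (forall x, D x -> 0 <= f x) -> (forall x, D x -> f x <= g x) ->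
  \int[mu]_(x in D) f x <= \int[mu]_(x in D) g x.
Proof.
move=> f0 fg.
rewrite !ge0_integralE//; last by move=> x Dx; exact: le_trans (f0 x Dx) (fg x Dx).
apply: le_ereal_sup => _ [h hf <-]; exists h => //= x.
exact: (le_trans (hf x) (lee_restrict fg x)).
Qed.

(** Only the smaller function has to be measurable: outside a measurable null
    set it lies below the larger one. *)
Lemma le_ge0_integral_ae (mu : {measure set T -> \bar R}) f g :
  measurable_fun setT f -> (forall x, 0 <= f x) -> (forall x, 0 <= g x) ->
  {ae mu, forall x, f x <= g x} ->
  \int[mu]_x f x <= \int[mu]_x g x.
Proof.
move=> mf f0 g0 [N [mN N0 Nfg]].
rewrite (ge0_negligible_integral mN measurableT mf _ N0)//.
rewrite integral_mkcond; apply: le_ge0_integral => x _.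
  by rewrite erestrict_ge0.
rewrite patchE; case: ifPn => //; rewrite inE => -[_ Nx].
by apply: contra_notP Nx => fgx; exact: Nfg.
Qed.

End integration.

(** * The exponential on the extended reals *)

Section exponential.
Context (R : realType).

Lemma measurable_expeR : measurable_fun [set: \bar R] expeR.
Proof.
apply: (measurability _ (ErealGenOInfty.measurableE R)).
move=> _ [_ [r ->] <-]; rewrite setTI.
have [r0|r0] := ltP r 0%R.
  rewrite (_ : _ @^-1` _ = setT); first exact: measurableT.
  apply/seteqP; split => // x _ /=.
  by rewrite in_itv/= andbT (lt_le_trans _ (expeR_ge0 x))// lte_fin.
rewrite (_ : _ @^-1` _ = `]lne r%:E, +oo]%classic); first exact: emeasurable_itv.
apply/seteqP; split => x; rewrite /= !in_itv/= ?andbT ?leey ?andbT;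
  by rewrite -(lte_expeR (lne r%:E)) lneK// in_itv/= lee_fin r0 leey.
Qed.

Lemma cvg_expeR (u : (\bar R)^nat) (l : \bar R) :
  u @ \oo --> l -> expeR (u n) @[n --> \oo] --> expeR l.
Proof.
case: l => [l| |] ul.
- have [fu cu] := (fine_cvgP _ _).1 ul.
  apply/fine_cvgP; split; first by apply: filterS fu => n; case: (u n).
  apply: (@cvg_trans _ (expR (fine (u n)) @[n --> \oo])).
    by apply: near_eq_cvg; apply: filterS fu => n /=; case: (u n).
  have c : {for l, continuous (@expR R)} by exact: continuous_expR.
  exact: (continuous_cvg _ c cu).
- apply/cvgeyPge => B; move/cvgeyPge : ul => /(_ B); apply: filterS => n Bu.
  apply: le_trans (expeR_ge1Dx _); apply: (le_trans Bu).
  by rewrite -[leLHS]add0e leeD2r.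
- have uNy (B : R) : \forall n \near \oo, u n <= B%:E.
    by move/cvgeNyPle : ul; exact.
  have fin n (B : R) : u n <= B%:E -> expeR (u n) \is a fin_num.
    by case: (u n).
  apply/fine_cvgP; split; first by apply: filterS (uNy 0%R) => n; exact: fin.
  apply/cvgr0Pnorm_lt => e e0; apply: filterS (uNy (ln (e / 2))) => n une.
  have e20 : (0 < e / 2)%R by rewrite divr_gt0.
  rewrite /= ger0_norm ?fine_ge0 ?expeR_ge0// -lte_fin fineK; last exact: fin une.
  apply: (@le_lt_trans _ _ (e / 2)%:E); last by rewrite lte_fin; lra.
  by rewrite -[(e/2)%:E]lneK ?lee_expeR ?lne_EFin// in_itv/= lee_fin ltW//= leey.
Qed.

(** Two errors of size [e], one in the functional and one in its mean, cost at
    most [2 * e] in the Laplace transform. *)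
Lemma expR_shift_le (x y e : R) : (0 <= x)%R -> (0 < e)%R ->
  (y <= x + e)%R -> (expR (- x) - 2 * e <= expR (- e) * expR (- y))%R.
Proof.
move=> x0 e0 yx.
have h : (expR (- x) * (1 - 2 * e) <= expR (- e) * expR (- y))%R.
  apply: (@le_trans _ _ (expR (- x) * expR (- (2 * e)))%R).
    by rewrite ler_wpM2l ?expR_ge0// expR_ge1Dx.
  by rewrite -!expRD ler_expR; lra.
apply: le_trans h.
have x1 : (expR (- x) <= 1)%R by rewrite -expR0 ler_expR oppr_le0.
have := expR_ge0 (- x); nra.
Qed.

End exponential.

Section integral_limits.
Context d (T : measurableType d) (R : realType).

Lemma nd_cvgeMl (c : \bar R) (u : (\bar R)^nat) l :
  0 <= c -> (forall n, 0 <= u n) -> nondecreasing_seq u ->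
  u @ \oo --> l -> (fun n => c * u n) @ \oo --> c * l.
Proof.
move=> c0 u0 ndu ul.
have uL n : u n <= l.
  rewrite (cvg_unique _ ul (ereal_nondecreasing_cvgn ndu))//.
  by apply: ereal_sup_ubound; exists n.
have [l0|l0] := eqVneq l 0.
  rewrite l0 mule0 (_ : (fun n => c * u n) = cst 0); first exact: cvg_cst.
  apply/funext => n; suff -> : u n = 0 by rewrite mule0.
  by apply/eqP; rewrite eq_le u0 andbT -l0.
have [->|c1] := eqVneq c 0.
  by rewrite mul0e; under eq_fun do rewrite mul0e; exact: cvg_cst.
apply: cvgeM => //; last exact: cvg_cst.
by apply: neq0_mule_def; rewrite mule_neq0.
Qed.

Lemma cvg_integral_nd (mu : {measure set T -> \bar R})
    (f_ : (T -> \bar R)^nat) f :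
  (forall n, measurable_fun setT (f_ n)) -> (forall n x, 0 <= f_ n x) ->
  (forall x, nondecreasing_seq (f_ ^~ x)) ->
  (forall x, f_ ^~ x @ \oo --> f x) ->
  \int[mu]_x f_ n x @[n --> \oo] --> \int[mu]_x f x.
Proof.
move=> mf f0 nd cf.
rewrite (_ : f = fun x => limn (f_ ^~ x)); last first.
  by apply/funext => x; apply/esym/cvg_lim.
by apply: cvg_monotone_convergence => //.
Qed.

End integral_limits.

(** * The Markov property for functions *)

Section markov.
Context (R : realType) d (E : measurableType d) (X : markov_process R E).

(** The sample space with F(I) as its sigma-algebra: a function that depends only
    on what happens during [I] is then a measurable function in the usual sense,
    and the closure properties of measurable functions apply to it. *)
Definition observed (I : interval R) := g_sigma_algebraType (events X I).

Lemma measurable_observed (I : interval R) (A : set (observed I)) :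
  [set` I] `<=` `[0%R, +oo[ -> measurable A -> events X I A.
Proof.
move=> I0; rewrite /measurable/= sigma_algebra_id//.
exact: events_sigma_algebra.
Qed.

Lemma observed_measurable_fun (I : interval R) d' (F : measurableType d')
    (f : observed I -> F) : [set` I] `<=` `[0%R, +oo[ ->
  measurable_fun setT f -> measurable_fun [set: sample X] f.
Proof.
move=> I0 mf _ B mB; rewrite setTI; apply: (events_measurable I0).
by apply: measurable_observed => //; rewrite -[X in measurable X]setTI; exact: mf.
Qed.

Lemma measurable_coord_observed (I : interval R) (t : R) :
  [set` I] `<=` `[0%R, +oo[ -> t \in I ->
  measurable_fun [set: observed I] (X t).
Proof.
move=> I0 tI _ B mB; rewrite setTI; apply: sub_sigma_algebra.
exact: events_coord.
Qed.

Lemma subset_itvcy0 (t : R) : (0 <= t)%R -> `[t, +oo[%classic `<=` `[0%R, +oo[.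
Proof. by move=> t0 x /=; rewrite !in_itv/= !andbT; exact: le_trans. Qed.

Lemma measurable_coord (t : R) : (0 <= t)%R ->
  measurable_fun [set: sample X] (X t).
Proof.
move=> t0; apply: (@observed_measurable_fun `[t, +oo[).
  exact: subset_itvcy0.
apply: measurable_coord_observed; first exact: subset_itvcy0.
by rewrite in_itv/= lexx.
Qed.

Lemma measurable_law_integral (t : R) (G : sample X -> \bar R) :
  measurable_fun setT G -> (forall w, 0 <= G w) ->
  measurable_fun setT (fun x : E => \int[law X t x]_w G w).
Proof.
move=> mG G0; apply: measurable_fun_integral_kernel => // U mU.
exact: measurable_kernel.
Qed.

Lemma measurable_law_coord (t : R) (G : sample X -> \bar R) : (0 <= t)%R ->
  measurable_fun setT G -> (forall w, 0 <= G w) ->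
  measurable_fun [set: sample X] (fun w => \int[law X t (X t w)]_w' G w').
Proof.
move=> t0 mG G0.
apply: (measurableT_comp (f := fun y => \int[law X t y]_w' G w')).
  exact: measurable_law_integral.
exact: measurable_coord.
Qed.

Lemma integrable_cst_law (r : R) (x : E) (M : R) :
  (law X r x).-integrable setT (cst M%:E).
Proof.
apply/integrableP; split; first exact: measurable_cst.
rewrite -[X in X < _]/(\int[law X r x]_w cst `|M%:E| w).
by rewrite integral_cst// prob_kernel mule1 ltry.
Qed.

Lemma markov_indic (r t : R) (x : E) (B : set E)
    (G : observed `[t, +oo[ -> \bar R) :
  (0 <= r)%R -> (r <= t)%R -> measurable B ->
  measurable_fun setT G -> (forall w, 0 <= G w) ->
  \int[law X r x]_w ((\1_B (X t w))%:E * G w) =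
  \int[law X r x]_w ((\1_B (X t w))%:E * \int[law X t (X t w)]_w' G w').
Proof.
move=> r0 rt mB; have t0 := le_trans r0 rt.
have I0 := subset_itvcy0 t0.
have mh : measurable_fun [set: sample X] (fun w => (\1_B (X t w))%:E : \bar R).
  apply/measurable_EFinP; apply: measurableT_comp; last exact: measurable_coord.
  exact: measurable_indic.
have h0 w : 0 <= (\1_B (X t w))%:E :> \bar R by rewrite lee_fin.
have mK (F : observed `[t, +oo[ -> \bar R) :
    measurable_fun setT F -> (forall w, 0 <= F w) ->
    measurable_fun [set: sample X] (fun w => \int[law X t (X t w)]_w' F w').
  move=> mF F0.
  by apply: measurable_law_coord => //; exact: observed_measurable_fun mF.
move: G; apply: (@ge0_measurable_ind _ (observed `[t, +oo[) R
  (fun G => \int[law X r x]_w ((\1_B (X t w))%:E * G w) =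
  \int[law X r x]_w ((\1_B (X t w))%:E * \int[law X t (X t w)]_w' G w'))) => /=.
- move=> D /(measurable_observed I0) mD.
  have mD' : measurable (D : set (sample X)) by exact: (events_measurable I0).
  have mC : measurable (X t @^-1` B : set (sample X)).
    by rewrite -[X in measurable X]setTI; exact: measurable_coord.
  transitivity (\int[law X r x]_w (\1_((X t @^-1` B) `&` D) w)%:E).
    by apply: eq_integral => w _; rewrite -EFinM indicI.
  rewrite integral_indic//; last first.
    exact: measurableI.
  rewrite setIT (markov_property _ r0 rt)//; last first.
    apply: events_coord => //; last by rewrite in_itv/= rt lexx.
    move=> y /=; rewrite !in_itv/= => /andP[+ _]; rewrite andbT.
    exact: le_trans.
  rewrite integral_mkcond; apply: eq_integral => w _.
  rewrite integral_indic// setIT patchE indicE.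
  rewrite -[w \in _]/(X t w \in B).
  by case: ifPn; rewrite ?mul1e ?mul0e.
- move=> a G a0 mG G0 IH.
  have mG' := observed_measurable_fun I0 mG.
  under eq_integral do rewrite muleCA.
  rewrite ge0_integralZl_EFin//; last 2 first.
  + by move=> w _; rewrite mule_ge0.
  + exact: emeasurable_funM.
  rewrite IH.
  under [in RHS]eq_integral do rewrite ge0_integralZl_EFin// muleCA.
  rewrite ge0_integralZl_EFin//.
    by move=> w _; rewrite mule_ge0// integral_ge0.
  by apply: emeasurable_funM => //; exact: mK.
- move=> F G mF mG F0 G0 IHF IHG.
  have mF' := observed_measurable_fun I0 mF.
  have mG' := observed_measurable_fun I0 mG.
  under eq_integral do rewrite ge0_muleDr//.
  rewrite ge0_integralD//; [|solve [by move=> w _; rewrite mule_ge0 |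
    exact: emeasurable_funM]..].
  rewrite IHF IHG -ge0_integralD//; last 4 first.
  + by move=> w _; rewrite mule_ge0// integral_ge0.
  + by apply: emeasurable_funM => //; exact: mK.
  + by move=> w _; rewrite mule_ge0// integral_ge0.
  + by apply: emeasurable_funM => //; exact: mK.
  apply: eq_integral => w _.
  by rewrite [in RHS]ge0_integralD// [RHS]ge0_muleDr//; exact: integral_ge0.
- move=> F_ F mF_ F_0 ndF cvF IH.
  have mF_' n := observed_measurable_fun I0 (mF_ n).
  have cL : \int[law X r x]_w ((\1_B (X t w))%:E * F_ n w) @[n --> \oo] -->
      \int[law X r x]_w ((\1_B (X t w))%:E * F w).
    apply: cvg_integral_nd.
    + by move=> n; exact: emeasurable_funM.
    + by move=> n w; rewrite mule_ge0.
    + by move=> w m n mn; apply: lee_wpmul2l => //; exact: ndF.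
    + by move=> w; apply: nd_cvgeMl.
  have cR : \int[law X r x]_w ((\1_B (X t w))%:E *
        \int[law X t (X t w)]_w' F_ n w') @[n --> \oo] -->
      \int[law X r x]_w ((\1_B (X t w))%:E * \int[law X t (X t w)]_w' F w').
    apply: cvg_integral_nd.
    + by move=> n; apply: emeasurable_funM => //; exact: mK.
    + by move=> n w; rewrite mule_ge0// integral_ge0.
    + move=> w m n mn; apply: lee_wpmul2l => //; apply: ge0_le_integral => //.
      by move=> w' _; exact: ndF.
    + move=> w; apply: nd_cvgeMl => //.
      * by move=> n; exact: integral_ge0.
      * by move=> m n mn; apply: ge0_le_integral => // w' _; exact: ndF.
      * exact: cvg_integral_nd.
  rewrite -(cvg_lim _ cL)// -(cvg_lim _ cR)//.
  by congr (limn _); apply/funext => n; exact: IH.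
Qed.

(** The induction is on the function of the present state; the case of an
    indicator is [markov_indic], which is itself obtained by induction on the
    function of the future from the Markov property of events. *)
Lemma markov_fun (r t : R) (x : E) (f : E -> \bar R)
    (G : observed `[t, +oo[ -> \bar R) :
  (0 <= r)%R -> (r <= t)%R ->
  measurable_fun setT f -> (forall x, 0 <= f x) ->
  measurable_fun setT G -> (forall w, 0 <= G w) ->
  \int[law X r x]_w (f (X t w) * G w) =
  \int[law X r x]_w (f (X t w) * \int[law X t (X t w)]_w' G w').
Proof.
move=> r0 rt mf f0 mG G0; have t0 := le_trans r0 rt.
have I0 := subset_itvcy0 t0.
have mG' := observed_measurable_fun I0 mG.
have mK : measurable_fun [set: sample X]
    (fun w => \int[law X t (X t w)]_w' G w').
  exact: measurable_law_coord.
have K0 w : 0 <= \int[law X t (X t w)]_w' G w' by exact: integral_ge0.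
have mc (g : E -> \bar R) : measurable_fun setT g ->
    measurable_fun [set: sample X] (fun w => g (X t w)).
  by move=> mg; apply: measurableT_comp => //; exact: measurable_coord.
move: f mf f0; apply: (@ge0_measurable_ind _ E R
  (fun f => \int[law X r x]_w (f (X t w) * G w) =
  \int[law X r x]_w (f (X t w) * \int[law X t (X t w)]_w' G w'))) => /=.
- by move=> D mD; exact: markov_indic.
- move=> a g a0 mg g0 IH.
  under eq_integral do rewrite -muleA.
  under [RHS]eq_integral do rewrite -muleA.
  rewrite !ge0_integralZl_EFin// ?IH//;
    by [move=> *; rewrite mule_ge0|apply: emeasurable_funM => //; exact: mc].
- move=> g h mg mh g0 h0 IHg IHh.
  under eq_integral do rewrite ge0_muleDl//.
  under [RHS]eq_integral do rewrite ge0_muleDl//.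
  rewrite !ge0_integralD// ?IHg ?IHh//;
    by [move=> *; rewrite mule_ge0|apply: emeasurable_funM => //; exact: mc].
- move=> g_ g mg g0 ndg cg IH.
  have key (H : sample X -> \bar R) : measurable_fun setT H ->
      (forall w, 0 <= H w) ->
      \int[law X r x]_w (g_ n (X t w) * H w) @[n --> \oo] -->
      \int[law X r x]_w (g (X t w) * H w).
    move=> mH H0; apply: cvg_integral_nd.
    + by move=> n; apply: emeasurable_funM => //; exact: mc.
    + by move=> n w; rewrite mule_ge0.
    + by move=> w m n mn; apply: lee_wpmul2r => //; exact: ndg.
    + move=> w; rewrite (muleC (g (X t w))).
      under eq_fun do rewrite muleC.
      by apply: nd_cvgeMl => //; move=> m n mn; exact: ndg.
  rewrite -(cvg_lim _ (key _ mG' G0))// -(cvg_lim _ (key _ mK K0))//.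
  by congr (limn _); apply/funext => n; exact: IH.
Qed.

End markov.

(** * The log-Laplace exponent of the total mass *)

Section total_mass_exponent.
Context (R : realType) (gamma beta : R).
Hypotheses (gamma_gt0 : (0 < gamma)%R) (beta_gt0 : (0 < beta)%R).
Local Open Scope ring_scope.

(** The solution at time [s] of y' = - gamma * y ^ (1 + beta) started at [c].
    It is what the log-Laplace equation becomes for a constant function, hence
    the log-Laplace exponent of [c] times the total mass after time [s]. *)
Definition mass_exponent (c s : R) : R :=
  c / (1 + gamma * beta * s * c `^ beta) `^ (1 / beta).

Lemma mass_exponent_den_ge1 (c s : R) : 0 <= s ->
  1 <= 1 + gamma * beta * s * c `^ beta.
Proof.
by move=> s0; rewrite lerDl !mulr_ge0 ?powR_ge0// ltW.
Qed.

Lemma mass_exponent_ge0 (c s : R) : 0 <= c -> 0 <= mass_exponent c s.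
Proof. by move=> c0; rewrite /mass_exponent divr_ge0 ?powR_ge0. Qed.

Lemma mass_exponent_time0 (c : R) : mass_exponent c 0 = c.
Proof. by rewrite /mass_exponent mulr0 mul0r addr0 powR1 divr1. Qed.

Lemma mass_exponent0 (s : R) : mass_exponent 0 s = 0.
Proof. by rewrite /mass_exponent mul0r. Qed.

(** The flow property of the differential equation, checked on the formula: the
    power [beta] of [mass_exponent c a] is [c `^ beta] divided by the
    denominator at time [a]. *)
Lemma mass_exponentD (c a b : R) : 0 <= c -> 0 <= a -> 0 <= b ->
  mass_exponent (mass_exponent c a) b = mass_exponent c (a + b).
Proof.
move=> c0 a0 b0.
have D1 := mass_exponent_den_ge1 c a0.
set Da := 1 + gamma * beta * a * c `^ beta in D1.
have Da0 : 0 < Da by exact: lt_le_trans D1.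
have e : mass_exponent c a `^ beta = c `^ beta / Da.
  rewrite /mass_exponent -/Da powRM ?invr_ge0 ?powR_ge0//; congr (_ * _).
  rewrite -(powR_inv1 (powR_ge0 _ _)) -!powRrM -(powR_inv1 (ltW Da0)).
  by congr (_ `^ _); field; rewrite gt_eqF.
have E0 : 0 <= 1 + gamma * beta * b * (c `^ beta / Da).
  by rewrite addr_ge0// !mulr_ge0 ?invr_ge0 ?powR_ge0 ?b0 ?(ltW gamma_gt0)
    ?(ltW beta_gt0) ?(ltW Da0).
rewrite {1}/mass_exponent e {1}/mass_exponent -/Da.
rewrite -mulrA -invfM -powRM ?(ltW Da0)//.
rewrite /mass_exponent; congr (_ / _ `^ _).
have := Da0; rewrite /Da => Da0'.
field.
exact: lt0r_neq0.
Qed.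

Lemma is_derive_powR_affine (a b p q : R) : 0 < b + a * q ->
  is_derive q 1 (fun x => (b + a * x) `^ p) (p * (b + a * q) `^ (p - 1) * a).
Proof.
move=> D0.
have dD : is_derive q (1 : R) (fun x : R => b + a * x) a.
  by apply: is_derive_eq; rewrite /GRing.scale/=; ring.
have dp := is_derive1_powR p D0.
exact: (is_derive1_comp (f := fun y : R => y `^ p)
  (g := fun x : R => b + a * x) dp dD).
Qed.

(** Integrated form of the differential equation, as it enters the log-Laplace
    equation.  With [b + a * q] denoting the denominator as an affine function
    of [q], an antiderivative of the integrand is
    [c / gamma * (b + a * q) `^ - (1 / beta)]. *)
Lemma integral_mass_exponent (c s t : R) : 0 <= c -> s <= t ->
  (\int[lebesgue_measure]_(q in `[s, t])
     (mass_exponent c (t - q) `^ (1 + beta))%:E =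
   ((c - mass_exponent c (t - s)) / gamma)%:E)%E.
Proof.
move=> c0; rewrite le_eqVlt => /predU1P[->|st].
  by rewrite subrr mass_exponent_time0 subrr mul0r set_itv1 integral_set1.
pose a := - (gamma * beta * c `^ beta).
pose b := 1 - a * t.
have bE q : 1 + gamma * beta * (t - q) * c `^ beta = b + a * q.
  by rewrite /b /a; ring.
have D0 q : q <= t -> 0 < b + a * q.
  by move=> qt; rewrite -bE (lt_le_trans ltr01)// mass_exponent_den_ge1// subr_ge0.
pose p := - (1 / beta).
pose F q := c / gamma * (b + a * q) `^ p.
pose f q := c `^ (1 + beta) * (b + a * q) `^ (p - 1).
have dF q : q <= t -> is_derive q (1 : R) F (f q).
  move=> qt; have dP := is_derive_powR_affine p (D0 _ qt).
  apply: is_derive_eq.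
  rewrite /GRing.scale/= /f.
  rewrite (@powRD _ c); last by rewrite (gt_eqF (addr_gt0 ltr01 beta_gt0)).
  rewrite powRr1// /p /a; field.
  by rewrite !gt_eqF.
have FE q : q <= t -> F q = mass_exponent c (t - q) / gamma.
  by move=> qt; rewrite /F /mass_exponent bE /p powRN; ring.
have fE q : q <= t -> mass_exponent c (t - q) `^ (1 + beta) = f q.
  move=> qt; rewrite /mass_exponent bE /f powRM ?invr_ge0 ?powR_ge0//; congr (_ * _).
  rewrite -(powR_inv1 (powR_ge0 _ _)) -!powRrM; congr (_ `^ _).
  rewrite /p; field.
  by rewrite gt_eqF.
transitivity (\int[lebesgue_measure]_(q in `[s, t]) (f q)%:E)%E.
  apply: eq_integral => q; rewrite inE/= in_itv/= => /andP[_ qt].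
  by rewrite fE.
have cF q : q <= t -> {for q, continuous F}.
  by move=> /dF[dFq _]; apply: differentiable_continuous; apply/derivable1_diffP.
have cP q : q <= t -> {for q, continuous (fun x : R => (b + a * x) `^ (p - 1))}.
  move=> qt; have [dq _] := is_derive_powR_affine (p - 1) (D0 _ qt).
  by apply: differentiable_continuous; apply/derivable1_diffP.
rewrite (@continuous_FTC2 _ f F)//.
- by rewrite !FE ?(ltW st)// subrr mass_exponent_time0 -EFinB -mulrBl.
- apply: continuous_in_subspaceT => q; rewrite inE/= in_itv/= => /andP[_ qt].
  by apply: cvgM; [exact: cvg_cst|exact: cP].
- split.
  + by move=> q; rewrite in_itv/= => /andP[_ /ltW /dF[]].
  + by apply: cvg_at_right_filter; apply: cF; exact: ltW.
  + by apply: cvg_at_left_filter; exact: cF.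
- move=> q; rewrite in_itv/= => /andP[_ /ltW /dF[_ e]].
  by rewrite derive1E.
Qed.

(** Coming down from infinity: a bound that does not depend on the initial
    value [c], which gives the estimate for extinction. *)
Lemma mass_exponent_le_inv (c s : R) : 0 <= c -> 0 < s ->
  mass_exponent c s <= 1 / (gamma * beta * s) `^ (1 / beta).
Proof.
move=> c0 s0.
have gbs : 0 < gamma * beta * s by rewrite !mulr_gt0.
rewrite /mass_exponent ler_pdivlMr ?powR_gt0//.
have D0 := lt_le_trans ltr01 (mass_exponent_den_ge1 c (ltW s0)).
rewrite mulrAC ler_pdivrMr ?powR_gt0//.
have cE : (c `^ beta) `^ (1 / beta) = c.
  by rewrite -powRrM mul1r divff ?gt_eqF// powRr1.
rewrite [leRHS]mul1r -{1}cE -powRM ?powR_ge0 ?(ltW gbs)//.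
apply: ge0_ler_powR; rewrite ?nnegrE.
- by rewrite divr_ge0// ltW.
- by rewrite mulr_ge0 ?powR_ge0// ltW.
- by rewrite (le_trans ler01)// mass_exponent_den_ge1// ltW.
- by rewrite mulrC lerDr.
Qed.

Lemma measurable_mass_exponent_sub (c t : R) :
  measurable_fun setT (fun q : R => mass_exponent c (t - q)).
Proof.
apply: measurable_funM => //.
rewrite [X in measurable_fun _ X](_ : _ = fun q : R =>
   (1 + gamma * beta * (t - q) * c `^ beta) `^ (- (1 / beta))); last first.
  by apply/funext => q; rewrite powRN.
apply: (measurableT_comp (measurable_powR _)).
apply: measurable_funD => //; apply: measurable_funM => //.
apply: measurable_funM => //.
exact: measurable_funB.
Qed.

End total_mass_exponent.

(** * Pairing bounded functions with finite measures *)

Section bounded_functions.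
Context (R : realType) d (E : measurableType d).
Implicit Types f g : E -> R.

Lemma bounded_pos_measurableD f g : bounded_pos_measurable f ->
  bounded_pos_measurable g -> bounded_pos_measurable (fun y => f y + g y)%R.
Proof.
move=> [mf f0 [M fM]] [mg g0 [N gN]]; split.
- exact: measurable_funD.
- by move=> y; rewrite addr_ge0.
- by exists (M + N)%R => y; rewrite lerD.
Qed.

Lemma bounded_pos_measurable_cst (c : R) : (0 <= c)%R ->
  bounded_pos_measurable (fun _ : E => c).
Proof. by move=> c0; split => //; exists c. Qed.

Lemma integral_bounded_le (mu : {measure set E -> \bar R}) f (M : R) :
  (forall y, 0 <= f y)%R -> (forall y, f y <= M)%R ->
  \int[mu]_y (f y)%:E <= M%:E * mu setT.
Proof.
move=> f0 fM; rewrite -integral_cst//.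
by apply: le_ge0_integral => y _; rewrite lee_fin.
Qed.

End bounded_functions.

Section finite_measure_pairing.
Context (R : realType) (S : ptopologicalType).
Implicit Types (f g : borel S -> R) (nu : finmeas (borel S) R).

Lemma measurable_integral_finmeas (f : borel S -> \bar R) :
  measurable_fun setT f -> (forall y, 0 <= f y) ->
  measurable_fun setT (fun nu : finmeas (borel S) R => \int[nu]_y f y).
Proof.
move=> mf f0.
apply: (measurable_fun_integral_kernel
  (l := fun nu : finmeas (borel S) R => (nu : {measure set (borel S) -> \bar R}))) => //.
move=> U mU _ V mV; rewrite setTI; apply: sub_sigma_algebra.
by exists U => //; exists V.
Qed.

Lemma measurable_pairing f : bounded_pos_measurable f ->
  measurable_fun setT (pairing f : finmeas (borel S) R -> \bar R).
Proof.
move=> [mf f0 _]; apply: measurable_integral_finmeas; first exact/measurable_EFinP.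
by move=> y; rewrite lee_fin.
Qed.

Lemma pairing_ge0 f nu : (forall y, 0 <= f y)%R -> 0 <= pairing f nu.
Proof. by move=> f0; apply: integral_ge0 => y _; rewrite lee_fin. Qed.

Lemma pairing_fin_num f nu : bounded_pos_measurable f ->
  pairing f nu \is a fin_num.
Proof.
move=> [mf f0 [M fM]]; rewrite ge0_fin_numE ?pairing_ge0//.
apply: (le_lt_trans (integral_bounded_le nu f0 fM)).
apply: lte_mul_pinfty => //.
  by rewrite lee_fin (le_trans (f0 point)).
by rewrite ltey_eq fin_num_measure.
Qed.

Lemma pairingD f g nu : bounded_pos_measurable f -> bounded_pos_measurable g ->
  pairing (fun y => f y + g y)%R nu = pairing f nu + pairing g nu.
Proof.
move=> [mf f0 _] [mg g0 _]; rewrite /pairing -ge0_integralD//.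
- by move=> y _; rewrite lee_fin.
- exact/measurable_EFinP.
- by move=> y _; rewrite lee_fin.
- exact/measurable_EFinP.
Qed.

Lemma pairing_cst (c : R) nu : (0 <= c)%R ->
  pairing (cst c) nu = c%:E * pairing (cst 1%R) nu.
Proof.
move=> c0; rewrite -[LHS]/(\int[nu]_y cst c%:E y).
by rewrite -[X in _ * X]/(\int[nu]_y cst 1%:E y) !integral_cst// mul1e.
Qed.

Lemma le_pairing f g nu : (forall y, 0 <= f y)%R -> (forall y, f y <= g y)%R ->
  pairing f nu <= pairing g nu.
Proof. by move=> f0 fg; apply: le_ge0_integral => y _; rewrite lee_fin. Qed.

Lemma pairing_dirac f (z : borel S) : measurable_fun setT f ->
  pairing f (\d_z : finmeas (borel S) R) = (f z)%:E.
Proof.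
move=> mf; rewrite /pairing integral_dirac//.
  by rewrite diracT mul1e.
exact/measurable_EFinP.
Qed.

Lemma pairing_zero f nu : zero_measure nu -> pairing f nu = 0.
Proof.
move=> nu0; rewrite /pairing.
rewrite (eq_measure_integral mzero); first exact: integral_measure_zero.
by move=> A mA _; apply: nu0.
Qed.

Lemma zero_measureP nu : zero_measure nu <-> pairing (cst 1%R) nu = 0.
Proof.
split; first exact: pairing_zero.
rewrite -[pairing _ _]/(\int[nu]_y cst 1%:E y) integral_cst// mul1e => nu0 B mB.
by apply/eqP; rewrite eq_le measure_ge0 andbT -nu0 le_measure// inE.
Qed.

End finite_measure_pairing.

(** * The log-Laplace equation *)

Section log_laplace.
Context (R : realType) (S : ptopologicalType) (Z : markov_process R (borel S)).
Variables (gamma beta : R).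
Hypotheses (gamma_gt0 : (0 < gamma)%R) (beta_gt0 : (0 < beta)%R).

Lemma log_laplace_solution_measurable f r t u s :
  log_laplace_solution Z gamma beta f r t u -> s \in `[r, t] ->
  measurable_fun setT (u s).
Proof.
move=> [mu _ _] srt.
apply: (measurable_comp (F := [set` `[r, t]] `*` [set: borel S])
  (f := fun p : R * borel S => u p.1 p.2) (g := fun y => (s, y))) => //.
  exact: measurableX.
  by move=> _ [y _ <-]; split.
exact: pair1_measurable.
Qed.

Lemma log_laplace_solution_sub f r s t u : (r <= s)%R ->
  log_laplace_solution Z gamma beta f r t u ->
  log_laplace_solution Z gamma beta f s t u.
Proof.
move=> rs [mu u0 ue].
have sub q : q \in `[s, t] -> q \in `[r, t].
  by rewrite !in_itv/= => /andP[sq ->]; rewrite (le_trans rs).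
split.
- apply: measurable_funS mu; first exact: measurableX.
  by move=> [q y] [/sub ? _]; split.
- by move=> q y /sub; exact: u0.
- by move=> q y /sub; exact: ue.
Qed.

(** A solution that does not depend on the state of the particle solves an
    ordinary differential equation. *)
Lemma log_laplace_solution_cst (c r t : R) : (0 <= c)%R ->
  log_laplace_solution Z gamma beta (cst c) r t
    (fun s _ => mass_exponent gamma beta c (t - s)).
Proof.
move=> c0; split.
- apply: measurable_funTS.
  exact: (measurableT_comp (measurable_mass_exponent_sub gamma beta c t) measurable_fst).
- by move=> s y _; exact: mass_exponent_ge0.
- move=> s y; rewrite in_itv/= => /andP[_ st].
  rewrite integral_mass_exponent//.
  rewrite -[X in X - _]/(\int[law Z s y]_w cst c%:E w).
  rewrite -[X in _ * X]/(\int[law Z s y]_w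
    cst ((c - mass_exponent gamma beta c (t - s)) / gamma)%:E w).
  rewrite !integral_cst// prob_kernel !mule1 -EFinM -EFinB; congr EFin.
  by field; rewrite gt_eqF.
Qed.

Context (X : markov_process R (finmeas (borel S) R)).
Hypothesis hX : superprocess Z gamma beta X.

(** Starting the superprocess from a unit mass at [y] recovers the value of the
    solution at [y] from a Laplace transform. *)
Lemma laplace_dirac f r t u : bounded_pos_measurable f ->
  (0 <= r)%R -> (r <= t)%R -> log_laplace_solution Z gamma beta f r t u ->
  forall y : borel S, \int[law X r (\d_y : finmeas (borel S) R)]_w
    expeR (- pairing f (X t w)) = (expR (- u r y))%:E.
Proof.
move=> bf r0 rt su y.
have [u1 [su1 uu1 e]] := hX.2 f r t bf r0 rt.
have rrt : r \in `[r, t] by rewrite in_itv/= lexx.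
rewrite e (uu1 _ su)// pairing_dirac//.
exact: log_laplace_solution_measurable su1 _.
Qed.

(** Comparison of solutions follows from the probabilistic representation
    [laplace_dirac]: a larger function has a smaller Laplace transform. *)
Lemma le_log_laplace_solution f g r t u v :
  bounded_pos_measurable f -> bounded_pos_measurable g ->
  (forall y, f y <= g y)%R -> (0 <= r)%R ->
  log_laplace_solution Z gamma beta f r t u ->
  log_laplace_solution Z gamma beta g r t v ->
  forall s y, s \in `[r, t] -> (u s y <= v s y)%R.
Proof.
move=> bf bg fg r0 su sv s y; rewrite in_itv/= => /andP[rs st].
have s0 := le_trans r0 rs.
rewrite -lerN2 -ler_expR -lee_fin.
rewrite -(laplace_dirac bg s0 st (log_laplace_solution_sub rs sv)).
rewrite -(laplace_dirac bf s0 st (log_laplace_solution_sub rs su)).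
apply: le_ge0_integral => w _; first exact: expeR_ge0.
rewrite lee_expeR leeN2; apply: le_pairing => //.
by case: bf.
Qed.

(** The heart of the argument.  By comparison, the solution [u] for [h + c] is at
    least the solution for the constant [c], so the nonlinear term subtracted in
    the equation of [u] is at least the one subtracted in the equation of
    [mass_exponent].  Subtracting the two equations leaves only the mean of
    [h]. *)
Lemma log_laplace_solution_shift_le h c r t u :
  bounded_pos_measurable h -> (0 <= c)%R -> (0 <= r)%R -> (r <= t)%R ->
  log_laplace_solution Z gamma beta (fun y => h y + c)%R r t u ->
  forall y, (u r y)%:E <=
    \int[law Z r y]_w (h (Z t w))%:E + (mass_exponent gamma beta c (t - r))%:E.
Proof.
move=> bh c0 r0 rt su y.
have bc := bounded_pos_measurable_cst (borel S) c0.
have rrt : r \in `[r, t] by rewrite in_itv/= lexx.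
have t0 := le_trans r0 rt.
have [mh h0 _] := bh.
have [_ u0 ->//] := su.
have [_ _ /(_ _ y rrt) ->] := log_laplace_solution_cst r t c0.
have mhZ : measurable_fun setT (fun w : sample Z => (h (Z t w))%:E).
  apply/measurable_EFinP; apply: (measurableT_comp mh).
  exact: measurable_coord.
have -> : \int[law Z r y]_w (h (Z t w) + c)%:E =
    \int[law Z r y]_w (h (Z t w))%:E + \int[law Z r y]_w (cst c (Z t w))%:E.
  rewrite -ge0_integralD//.
  - by move=> w _; rewrite lee_fin.
  - exact: (@measurable_cst _ _ _ _ _ c%:E).
(* Only the order of the nonlinear terms matters; the inequality is isolated
   over variables to keep rewriting away from the integrals. *)
have sub_le (a b p q : \bar R) : p <= q -> a + b - q <= a + (b - p).
  by move=> pq; rewrite -addeA leeD2l// leeB.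
apply: sub_le; apply: lee_wpmul2l; first by rewrite lee_fin ltW.
apply: le_ge0_integral => w _.
  by apply: integral_ge0 => q _; rewrite lee_fin powR_ge0.
apply: le_ge0_integral => q qrt; first by rewrite lee_fin powR_ge0.
have [_ exponent_pos _] := log_laplace_solution_cst r t c0.
rewrite lee_fin ge0_ler_powR ?nnegrE ?addr_ge0 ?(ltW beta_gt0)//.
- exact: exponent_pos (Z q w) qrt.
- exact: u0.
- apply: (le_log_laplace_solution bc _ _ r0 (log_laplace_solution_cst r t c0) su) => //.
    exact: bounded_pos_measurableD bh bc.
  by move=> x; rewrite lerDr.
Qed.

End log_laplace.

(** * Functionals with finitely many atoms *)

Section finitely_many_atoms.
Context (R : realType) (S : ptopologicalType) (Z : markov_process R (borel S)).
Variables (gamma beta : R).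
Hypotheses (gamma_gt0 : (0 < gamma)%R) (beta_gt0 : (0 < beta)%R).
Context (X : markov_process R (finmeas (borel S) R)).
Hypothesis hX : superprocess Z gamma beta X.

(** One backward step from [t] to [r].  The function [g] that has to be
    transported is only known to lie below [h + c]; monotonicity reduces the
    bound to [log_laplace_solution_shift_le]. *)
Lemma superprocess_step g h c r t :
  bounded_pos_measurable g -> bounded_pos_measurable h -> (0 <= c)%R ->
  (forall y, g y <= h y + c)%R -> (0 <= r)%R -> (r <= t)%R ->
  exists v : borel S -> R, [/\ bounded_pos_measurable v,
    forall mu : finmeas (borel S) R,
      \int[law X r mu]_w expeR (- pairing g (X t w)) =
      expeR (- pairing v mu) &
    forall y, (v y)%:E <= \int[law Z r y]_w (h (Z t w))%:E +
                          (mass_exponent gamma beta c (t - r))%:E].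
Proof.
move=> bg bh c0 ghc r0 rt.
have bhc := bounded_pos_measurableD bh (bounded_pos_measurable_cst (borel S) c0).
have [u [su _ eu]] := hX.2 g r t bg r0 rt.
have [u' [su' _ _]] := hX.2 (fun y => h y + c)%R r t bhc r0 rt.
have rrt : r \in `[r, t] by rewrite in_itv/= lexx.
exists (u r); split => //; last first.
  move=> y; apply: le_trans (log_laplace_solution_shift_le
    gamma_gt0 beta_gt0 hX bh c0 r0 rt su' y).
  by rewrite lee_fin; exact: (le_log_laplace_solution hX bg bhc ghc r0 su su').
split.
- exact: log_laplace_solution_measurable su _.
- by move=> y; case: su => _ + _; exact.
- have [_ g0 [M gM]] := bg; exists M => y; rewrite -lee_fin.
  have [_ u0 ->//] := su.
  have gM1 : \int[law Z r y]_w (g (Z t w))%:E <= M%:E.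
    apply: (le_trans (integral_bounded_le _ _ (fun w => gM (Z t w)))) => //.
    by rewrite prob_kernel mule1.
  apply: le_trans gM1; rewrite -[leRHS]adde0 leeD2l// oppe_le0.
  rewrite mule_ge0 ?lee_fin ?(ltW gamma_gt0)//; apply: integral_ge0 => w _.
  by apply: integral_ge0 => q _; rewrite lee_fin powR_ge0.
Qed.

Lemma mean_bounded_pos_measurable h r t : (0 <= t)%R ->
  bounded_pos_measurable h ->
  exists m : borel S -> R, bounded_pos_measurable m /\
    forall y, (m y)%:E = \int[law Z r y]_w (h (Z t w))%:E.
Proof.
move=> t0 [mh h0 [M hM]].
have I0 y : 0 <= \int[law Z r y]_w (h (Z t w))%:E.
  by apply: integral_ge0 => w _; rewrite lee_fin.
have IM y : \int[law Z r y]_w (h (Z t w))%:E <= M%:E.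
  apply: (le_trans (integral_bounded_le _ _ (fun w => hM (Z t w)))) => //.
  by rewrite prob_kernel mule1.
have If y : \int[law Z r y]_w (h (Z t w))%:E \is a fin_num.
  by rewrite ge0_fin_numE// (le_lt_trans (IM y))// ltry.
exists (fun y => fine (\int[law Z r y]_w (h (Z t w))%:E)); split; last first.
  by move=> y; rewrite fineK.
split.
- apply: (measurableT_comp (fine_measurable _)) => //.
  apply: measurable_law_integral; last by move=> w; rewrite lee_fin.
  apply/measurable_EFinP.
  exact: (measurableT_comp mh (measurable_coord t0)).
- by move=> y; rewrite fine_ge0.
- by exists M => y; rewrite -lee_fin fineK.
Qed.

Section atoms.
Context (I : Type) (t : I -> R) (f : I -> borel S -> R) (c : I -> R).
Hypothesis f_bounded : forall i, bounded_pos_measurable (f i).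
Hypothesis c_ge0 : forall i, (0 <= c i)%R.

(** The log-Laplace exponent at time [r] of the functional with constant weight
    [c i] at each time [t i]; the list [s] has to be ordered by time. *)
Fixpoint cst_exponent (r : R) (s : seq I) : R :=
  if s is i :: s'
  then mass_exponent gamma beta (c i + cst_exponent (t i) s') (t i - r)
  else 0%R.

Lemma cst_exponent_ge0 r s : (0 <= cst_exponent r s)%R.
Proof. by elim: s r => //= i s IH r; rewrite mass_exponent_ge0// addr_ge0. Qed.

Lemma atom_bounded i : bounded_pos_measurable (fun y => f i y + c i)%R.
Proof.
exact: bounded_pos_measurableD (f_bounded i) (bounded_pos_measurable_cst _ (c_ge0 i)).
Qed.

Lemma measurable_atoms_observed (r : R) s : (0 <= r)%R ->
  all (fun i => r <= t i)%R s ->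
  measurable_fun [set: observed X `[r, +oo[]
   (fun w => \sum_(i <- s) pairing (fun y => f i y + c i)%R (X (t i) w)).
Proof.
move=> r0; elim: s => [|i s IH] /=.
  by move=> _; under eq_fun do rewrite big_nil; exact: measurable_cst.
move=> /andP[ri rs]; under eq_fun do rewrite big_cons.
apply: emeasurable_funD; last exact: IH.
apply: (measurableT_comp (measurable_pairing (atom_bounded i))).
apply: measurable_coord_observed; first exact: subset_itvcy0.
by rewrite in_itv/= ri.
Qed.

Lemma measurable_mean_observed (r : R) s : (0 <= r)%R ->
  all (fun i => r <= t i)%R s ->
  measurable_fun [set: observed Z `[r, +oo[]
    (fun w => \sum_(i <- s) (f i (Z (t i) w))%:E).
Proof.
move=> r0; elim: s => [|i s IH] /=.
  by move=> _; under eq_fun do rewrite big_nil; exact: measurable_cst.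
move=> /andP[ri rs]; under eq_fun do rewrite big_cons.
apply: emeasurable_funD; last exact: IH.
apply/measurable_EFinP; have [mf _ _] := f_bounded i.
apply: (measurableT_comp mf).
apply: measurable_coord_observed; first exact: subset_itvcy0.
by rewrite in_itv/= ri.
Qed.

(** Each atom has a weight [f i] whose contribution is bounded by its mean, and a
    constant weight [c i] whose contribution is kept exactly.  The induction
    removes the first atom: the Markov property of the superprocess at its time
    replaces the later atoms by their log-Laplace exponent [v'], which is added
    to the weight of the first atom, and the Markov property of the one-particle
    motion makes the means add up. *)
Lemma atoms_exponent_le (s : seq I) (r : R) : (0 <= r)%R ->
  path <=%R r (map t s) ->
  exists v m : borel S -> R,
   [/\ bounded_pos_measurable v, bounded_pos_measurable m,
    forall mu : finmeas (borel S) R,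
      \int[law X r mu]_w expeR
         (- \sum_(i <- s) pairing (fun y => f i y + c i)%R (X (t i) w)) =
      expeR (- pairing v mu),
    forall y, (m y)%:E = \int[law Z r y]_w \sum_(i <- s) (f i (Z (t i) w))%:E &
    forall y, (v y <= m y + cst_exponent r s)%R].
Proof.
elim: s r => [|i s IH] r r0 /=.
  move=> _; exists (cst 0%R), (cst 0%R).
  have b0 : bounded_pos_measurable (cst 0%R : borel S -> R).
    exact: bounded_pos_measurable_cst.
  split => //.
  - move=> mu; under eq_integral do rewrite big_nil oppe0 expeR0.
    rewrite -[LHS]/(\int[law X r mu]_w cst 1 w) integral_cst// prob_kernel mule1.
    by rewrite pairing_cst// mul0e oppe0 expeR0.
  - by move=> y; under eq_integral do rewrite big_nil; rewrite integral0.
  - by move=> y; rewrite addr0.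
move=> /andP[rt pts]; have t0 := le_trans r0 rt.
have ts : all (fun j => t i <= t j)%R s.
  by have := order_path_min le_trans pts; rewrite all_map.
have [v' [m' [bv' bm' ev' em' v'm']]] := IH _ t0 pts.
have bg : bounded_pos_measurable (fun y => (f i y + c i) + v' y)%R.
  exact: bounded_pos_measurableD (atom_bounded i) bv'.
have bh : bounded_pos_measurable (fun y => f i y + m' y)%R.
  exact: bounded_pos_measurableD (f_bounded i) bm'.
have k0 : (0 <= c i + cst_exponent (t i) s)%R.
  by rewrite addr_ge0// cst_exponent_ge0.
have [y|v [bv ev vm]] := superprocess_step bg bh k0 _ r0 rt.
  by rewrite addrACA lerD2l.
have [m [bm em]] := mean_bounded_pos_measurable r t0 bh.
exists v, m; split => //.
- move=> mu; rewrite -ev.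
  pose G w := expeR (- \sum_(j <- s) pairing (fun y => f j y + c j)%R (X (t j) w)).
  transitivity (\int[law X r mu]_w
     (expeR (- pairing (fun y => f i y + c i)%R (X (t i) w)) * G w)).
    apply: eq_integral => w _; rewrite big_cons -expeRD; congr expeR.
    apply/oppeD/fin_num_adde_defr/pairing_fin_num.
    exact: (atom_bounded i).
  rewrite (markov_fun _ (f := fun nu => expeR (- pairing _ nu)) r0 rt).
  + apply: eq_integral => w _; rewrite ev' -expeRD; congr expeR.
    rewrite (pairingD _ (atom_bounded i) bv').
    apply/esym/oppeD/fin_num_adde_defr/pairing_fin_num.
    exact: (atom_bounded i).
  + apply: (measurableT_comp (@measurable_expeR R)).
    apply: measurableT_comp => //.
    exact: measurable_pairing (atom_bounded i).
  + by move=> x; exact: expeR_ge0.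
  + apply: (measurableT_comp (@measurable_expeR R)).
    apply: measurableT_comp => //.
    exact: measurable_atoms_observed.
  + by move=> w; exact: expeR_ge0.
- move=> y; rewrite em.
  have I0 := subset_itvcy0 t0.
  have mG := measurable_mean_observed t0 ts.
  have mG' := observed_measurable_fun I0 mG.
  have f0 j x : (0 <= f j x)%R by case: (f_bounded j).
  have m'0 x : (0 <= m' x)%R by case: bm'.
  have G0 w : 0 <= \sum_(j <- s) (f j (Z (t j) w))%:E.
    by apply: sume_ge0 => j _; rewrite lee_fin.
  have mc g : bounded_pos_measurable g ->
      measurable_fun [set: sample Z] (fun w => (g (Z (t i) w))%:E).
    move=> [mg _ _]; apply/measurable_EFinP.
    exact: (measurableT_comp mg (measurable_coord t0)).
  under eq_integral do rewrite EFinD.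
  under [RHS]eq_integral do rewrite big_cons.
  rewrite !ge0_integralD//; [|solve [by move=> w _; rewrite lee_fin | exact: mc]..].
  congr (_ + _).
  have := markov_fun y (f := cst 1) r0 rt _ _ mG G0.
  under eq_integral do rewrite mul1e.
  under [X in _ -> _ -> _ = X]eq_integral do rewrite mul1e -em'.
  by move=> <-.
- by move=> y; rewrite -lee_fin EFinD em.
Qed.

End atoms.
End finitely_many_atoms.

Section one_constant_atom.
Context (R : realType) (gamma beta : R).
Hypotheses (gamma_gt0 : (0 < gamma)%R) (beta_gt0 : (0 < beta)%R).

(** By the flow property, times at which the constant weight vanishes can be
    skipped. *)
Lemma cst_exponent_single (I : eqType) (t c : I -> R) (i0 : I) (s : seq I) r :
  (0 <= c i0)%R -> (forall i, i != i0 -> c i = 0%R) -> uniq s ->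
  path <=%R r (map t s) ->
  cst_exponent gamma beta t c r s =
    if i0 \in s then mass_exponent gamma beta (c i0) (t i0 - r) else 0%R.
Proof.
move=> c0 ci0; elim: s r => [//|i s IH] r /= /andP[si us] /andP[ri pts].
rewrite IH// inE eq_sym; have [ii0|ii0] /= := eqVneq i i0.
  by rewrite -{1}ii0 (negbTE si) addr0 ii0.
rewrite (ci0 _ ii0) add0r; case: ifPn => [si0|_]; last by rewrite mass_exponent0.
have /allP ts := order_path_min le_trans pts.
have tt0 : (t i <= t i0)%R by apply: ts; exact: map_f.
rewrite mass_exponentD ?subr_ge0//; congr mass_exponent; ring.
Qed.

End one_constant_atom.

Section finitely_supported_functionals.
Context (R : realType) (S : ptopologicalType) (Z : markov_process R (borel S)).
Variables (gamma beta : R).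
Hypotheses (gamma_gt0 : (0 < gamma)%R) (beta_gt0 : (0 < beta)%R).
Context (X : markov_process R (finmeas (borel S) R)).
Hypothesis hX : superprocess Z gamma beta X.

(** The defining formula is for bounded intervals; continuity from below extends
    it, the approximating sequence being eventually constant. *)
Lemma atomic_at_half_line (A : sample Z -> {measure set R -> \bar R})
    n t f r w :
  @atomic_at R S Z A n t f -> (0 <= r)%R ->
  A w `[r, +oo[%classic = \sum_(i < n | (r <= t i)%R) (f i (Z (t i) w))%:E.
Proof.
move=> [_ _ _ At] r0.
pose B (m : nat) := `[r, (r + m%:R)%R]%classic.
have cB : A w (B m) @[m --> \oo] --> A w (\bigcup_m B m).
  apply: nondecreasing_cvg_mu => //.
  - by move=> m; exact: measurable_itv.
  - by apply: bigcup_measurable => m _; exact: measurable_itv.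
  - move=> m p mp; apply/subsetPset => x; rewrite /B/= !in_itv/= => /andP[->/=].
    by move=> /le_trans; apply; rewrite lerD2l ler_nat.
have <- : \bigcup_m B m = `[r, +oo[%classic.
  apply/seteqP; split => x; rewrite /B/= in_itv/= ?andbT.
    by move=> [m _ /=]; rewrite in_itv/= => /andP[].
  move=> rx; exists (Num.truncn (x - r)).+1 => //=; rewrite in_itv/= rx/=.
  by rewrite -lerBlDl ltW// truncnS_gt.
apply: (cvg_unique _ cB) => //.
pose N := (\sum_(i < n) (Num.truncn (t i - r)).+1)%N.
apply: cvg_near_cst.
exists N => // m /= Nm.
rewrite /B At ?lerDl//; apply: eq_bigl => i.
case: (leP r (t i)) => //= rt; apply/idP.
rewrite -lerBlDl (le_trans (ltW (truncnS_gt _)))// ler_nat (leq_trans _ Nm)//.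
by rewrite /N (bigD1 i)//= leq_addr.
Qed.

(** The total mass at time [T] is inserted as an additional atom of constant
    weight [k], indexed by [None].  Atoms before the starting time [r] are
    dropped, as the superprocess vanishes there; atoms after [T] are allowed,
    because the approximations of a functional that stops at [T] may have
    some. *)
Lemma atomic_laplace_ge (k T r : R) (z : borel S) n t f
    (A : sample Z -> {measure set R -> \bar R}) (J : sample X -> \bar R) :
  (0 <= k)%R -> (0 <= r)%R -> (r <= T)%R -> @atomic_at R S Z A n t f ->
  {ae law X r (\d_z : finmeas (borel S) R), forall w,
     J w = \sum_(i < n) pairing (f i) (X (t i) w)} ->
  expeR (- (\int[law Z r z]_w A w `[r, +oo[%classic +
            (mass_exponent gamma beta k (T - r))%:E)) <=
  \int[law X r (\d_z : finmeas (borel S) R)]_w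
     expeR (- J w - k%:E * pairing (cst 1%R) (X T w)).
Proof.
move=> k0 r0 rT Aat aeJ; have [t0 _ bf _] := Aat.
pose t' (i : option 'I_n) := if i is Some j then t j else T.
pose f' (i : option 'I_n) := if i is Some j then f j else cst 0%R.
pose c' (i : option 'I_n) := if i is Some j then 0%R else k.
have bf' i : bounded_pos_measurable (f' i).
  by case: i => [j|]/=; [exact: bf|exact: bounded_pos_measurable_cst].
have c'0 i : (0 <= c' i)%R by case: i.
pose s0 := [seq i <- None :: map Some (enum 'I_n) | (r <= t' i)%R].
pose leT i j := (t' i <= t' j)%R.
pose s := path.sort leT s0.
have us : uniq s.
  rewrite sort_uniq filter_uniq//= map_inj_uniq ?enum_uniq ?andbT; last exact: Some_inj.
  by apply/mapP => -[].
have Ns : None \in s by rewrite mem_sort mem_filter inE eqxx/= rT.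
have ps : path <=%R r (map t' s).
  rewrite path_min_sorted; last first.
    by rewrite all_map all_sort; apply/allP => i; rewrite mem_filter => /andP[].
  rewrite sorted_map; apply: sort_sorted => i j; exact: le_total.
have [v [m [bv bm ev em vm]]] :=
  atoms_exponent_le gamma_gt0 beta_gt0 hX bf' c'0 r0 ps.
have sumE (F : option 'I_n -> \bar R) : \sum_(i <- s) F i =
    F None + \sum_(i < n | (r <= t i)%R) F (Some i).
  rewrite (perm_big s0)/=; last by rewrite /s perm_sort.
  by rewrite /s0 /= rT big_cons big_filter big_map big_enum_cond.
have -> : \int[law Z r z]_w A w `[r, +oo[%classic = (m z)%:E.
  rewrite em; apply: eq_integral => w _.
  by rewrite (atomic_at_half_line _ Aat)// sumE /= add0e.
have ec : cst_exponent gamma beta t' c' r s = mass_exponent gamma beta k (T - r).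
  rewrite (cst_exponent_single gamma_gt0 beta_gt0 (i0 := None))//.
    by rewrite Ns.
  by case.
have [mv _ _] := bv.
apply: (@le_trans _ _ (expeR (- pairing v (\d_z : finmeas (borel S) R)))).
  by rewrite lee_expeR leeN2 pairing_dirac// -EFinD lee_fin -ec.
rewrite -ev; apply: le_ge0_integral_ae.
- apply: (measurableT_comp (@measurable_expeR R)); apply: measurableT_comp => //.
  apply: (observed_measurable_fun (I := `[r, +oo[)); first exact: subset_itvcy0.
  apply: measurable_atoms_observed => //.
  by rewrite all_sort; apply/allP => i; rewrite mem_filter => /andP[].
- by move=> w; exact: expeR_ge0.
- by move=> w; exact: expeR_ge0.
have ae0 : {ae law X r (\d_z : finmeas (borel S) R), forall w,
    forall i : 'I_n, (t i < r)%R -> zero_measure (X (t i) w)}.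
  apply: filter_forall => i; have [tr|rt] := ltP (t i) r; last exact: aeW.
  by have := hX.1 r (t i) (\d_z : finmeas (borel S) R) (t0 i) tr; apply: filterS.
apply: filterS2 aeJ ae0 => w -> Xt0; rewrite lee_expeR sumE /=.
rewrite [X in _ <= - X - _](bigID (fun i => r <= t i)%R)/=.
rewrite [X in _ <= - (_ + X) - _]big1 ?adde0; last first.
  by move=> i; rewrite -ltNge => /Xt0; exact: pairing_zero.
have -> : pairing (fun y => cst 0%R y + k)%R (X T w) =
    k%:E * pairing (cst 1%R) (X T w).
  rewrite -pairing_cst//; congr pairing; apply/funext => y; exact: add0r.
have b1 : bounded_pos_measurable (cst 1%R : borel S -> R).
  exact: bounded_pos_measurable_cst.
rewrite oppeD; last first.
  by rewrite fin_num_adde_defr// fin_numM// pairing_fin_num.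
rewrite addeC leeD2r// leeN2; apply: lee_sum => i _.
apply: le_pairing => [y|y]; last by rewrite addr0.
by case: (bf i).
Qed.

End finitely_supported_functionals.

(** * Passage to the limit *)

Section limits_of_atomic_functionals.
Context (R : realType) (S : ptopologicalType) (Z : markov_process R (borel S)).
Variables (gamma beta : R).
Hypotheses (gamma_gt0 : (0 < gamma)%R) (beta_gt0 : (0 < beta)%R).
Context (X : markov_process R (finmeas (borel S) R)).
Hypothesis hX : superprocess Z gamma beta X.

Lemma measurable_atomic_half_line
    (A : sample Z -> {measure set R -> \bar R}) n t f r :
  @atomic_at R S Z A n t f -> (0 <= r)%R ->
  measurable_fun setT (fun w => A w `[r, +oo[%classic).
Proof.
move=> Aat r0; have [t0 _ bf _] := Aat.
under eq_fun do rewrite (atomic_at_half_line _ Aat r0) big_mkcond.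
apply: emeasurable_sum => i; case: (r <= t i)%R; last exact: measurable_cst.
apply/measurable_EFinP; have [mf _ _] := bf i.
exact: (measurableT_comp mf (measurable_coord (t0 i))).
Qed.

Lemma half_line_mass_le (mu : {measure set R -> \bar R}) (r T M : R) :
  (0 <= r)%R -> (0 <= T)%R ->
  mu `[T, +oo[%classic = 0 -> mu `[0%R, T]%classic <= M%:E ->
  mu `[r, +oo[%classic <= M%:E.
Proof.
move=> r0 T0 muT muM.
apply: (@le_trans _ _ (mu (`[0%R, T]%classic `|` `[T, +oo[%classic))).
  apply: le_measure; rewrite ?inE; [exact: measurable_itv|exact: measurableU|].
  move=> x /=; rewrite !in_itv/= !andbT => rx.
  by have [xT|/ltW Tx] := leP x T; [left; rewrite (le_trans r0)|right].
apply: (le_trans (measureU2 _ _ _)) => //; try exact: measurable_itv.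
have muT0 : mu `[T, +oo[%classic <= 0 by rewrite muT.
by rewrite -[leRHS]adde0; exact: leeD muM muT0.
Qed.

Lemma pairing_sum_fin_num n (t : 'I_n -> R) (f : 'I_n -> borel S -> R) w :
  (forall i, bounded_pos_measurable (f i)) ->
  \sum_(i < n) pairing (f i) (X (t i) w) \is a fin_num.
Proof.
by move=> bf; apply/sum_fin_numP => i _ _; exact: pairing_fin_num.
Qed.

(** Convergence in probability is used through this pointwise inequality: where
    the approximation [j] is within [e] of [x] the exponentials compare up to the
    factor [expR (- e)], and elsewhere the indicator pays.  The limit [x] is only
    almost surely nonnegative; its absolute value replaces it so that the
    exponential stays at most 1. *)
Lemma expeR_shift_indic (j q e : R) (x : \bar R) :
  (0 <= j)%R -> (0 <= q)%R -> (0 < e)%R ->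
  (expR (- e))%:E * expeR (- j%:E - q%:E) <=
  expeR (- `|x| - q%:E) + (\1_[set y | (e%:E <= `|j%:E - y|)%E] x)%:E.
Proof.
move=> j0 q0 e0; rewrite indicE.
have [ex|] := boolP (e%:E <= `|j%:E - x|).
  rewrite mem_set//.
  apply: (@le_trans _ _ 1); last by rewrite leeDr// expeR_ge0.
  rewrite /= -EFinM -expRD lee_fin -expR0 ler_expR; lra.
move=> xe; rewrite memNset; last exact/negP.
move: xe; rewrite adde0 -ltNge; case: x => [x||]//=.
rewrite lte_fin => jx; rewrite -EFinM -expRD lee_fin ler_expR.
have : (`|x| <= j + `|j - x|)%R.
  by rewrite -{1}(subKr j x) (le_trans (ler_normB _ _))// lerD2r ger0_norm.
lra.
Qed.

(** The masses of the approximations are bounded, so their means converge by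
    dominated convergence.  The bound [g] is arbitrary because, in the next
    step, it is the mass of another functional, approximated from below by [A],
    on a bounded interval; it need not be measurable. *)
Lemma Jversion2_laplace_ge (k T r : R) (z : borel S)
    (A : sample Z -> {measure set R -> \bar R}) (J : sample X -> \bar R)
    (g : sample Z -> \bar R) :
  (0 <= k)%R -> (0 <= r)%R -> (r <= T)%R ->
  Jversion2 r (\d_z : finmeas (borel S) R) A J ->
  (forall w, 0 <= g w) ->
  {ae law Z r z, forall w, A w `[r, +oo[%classic <= g w} ->
  expeR (- (\int[law Z r z]_w g w + (mass_exponent gamma beta k (T - r))%:E)) <=
  \int[law X r (\d_z : finmeas (borel S) R)]_w
     expeR (- `|J w| - k%:E * pairing (cst 1%R) (X T w)).
Proof.
move=> k0 r0 rT [mJ _ [A_ [J_ [[_ aecv [T' [T'0 AT' [M AM]]]] J1 cvP]]]] g0 Ag.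
set P := law Z r z; set Q := law X r _.
have T0 := le_trans r0 rT.
have at_ m : exists n t f, @atomic_at R S Z (A_ m) n t f /\
    {ae Q, forall w, J_ m w = \sum_(i < n) pairing (f i) (X (t i) w)}.
  by have [] := J1 m.
have mJ_ m : measurable_fun setT (J_ m) by have [] := J1 m.
pose a m w := A_ m w `[r, +oo[%classic.
have ma m : measurable_fun setT (a m).
  by have [n [t [f [Aat _]]]] := at_ m; exact: measurable_atomic_half_line Aat r0.
have aM m w : a m w <= M%:E by exact: half_line_mass_le (ltW T'0) (AT' m w) (AM m w).
have a0 m w : 0 <= a m w by exact: measure_ge0.
have M0 : (0 <= M)%R by rewrite -lee_fin (le_trans (a0 0%N point)).
(* A measurable version of the limit mass, nonnegative everywhere. *)
pose G w := `|limn_esup (a ^~ w)|.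
have mG : measurable_fun setT G.
  by apply: measurableT_comp => //; exact: measurable_fun_limn_esup.
have GE w : a m w @[m --> \oo] --> A w `[r, +oo[%classic ->
    G w = A w `[r, +oo[%classic.
  move=> cw; rewrite /G is_cvg_limn_esupE; first by rewrite (cvg_lim _ cw)// gee0_abs.
  by apply/cvg_ex; exists (A w `[r, +oo[%classic).
have [iG _ cI] : [/\ P.-integrable setT G,
    \int[P]_w `|a m w - G w| @[m --> \oo] --> 0 &
    \int[P]_w a m w @[m --> \oo] --> \int[P]_w G w].
  apply: (@dominated_convergence _ _ _ P setT measurableT a G (cst M%:E)) => //.
  - by apply: filterS (aecv r z r0) => w cw _; rewrite (GE w cw).
  - exact: integrable_cst_law.
  - by apply: aeW => w m _; rewrite gee0_abs.
have G0 w : 0 <= G w by exact: abse_ge0.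
have Gg : \int[P]_w G w <= \int[P]_w g w.
  apply: le_ge0_integral_ae => //.
  by apply: filterS2 (aecv r z r0) Ag => w cw; rewrite (GE w cw).
have Gfin : \int[P]_w G w \is a fin_num.
  exact: integrable_fin_num iG.
pose G1 := fine (\int[P]_w G w).
have G1E : \int[P]_w G w = G1%:E by rewrite /G1 fineK.
have G10 : (0 <= G1)%R by rewrite fine_ge0// integral_ge0.
pose ph := mass_exponent gamma beta k (T - r).
have ph0 : (0 <= ph)%R by exact: mass_exponent_ge0.
apply: (@le_trans _ _ (expR (- (G1 + ph)))%:E).
  rewrite -[leRHS]/(expeR (- (G1 + ph)%:E)) lee_expeR leeN2 EFinD leeD2r//.
  by rewrite -G1E.
pose p w := pairing (cst 1%R) (X T w) : \bar R.
have b1 : bounded_pos_measurable (cst 1%R : borel S -> R).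
  exact: bounded_pos_measurable_cst.
have mp : measurable_fun setT p.
  exact: (measurableT_comp (measurable_pairing b1) (measurable_coord T0)).
have pf w : p w \is a fin_num by exact: pairing_fin_num.
have p0 w : 0 <= p w by exact: pairing_ge0.
have mkp (H : sample X -> \bar R) : measurable_fun setT H ->
    measurable_fun setT (fun w => expeR (- H w - k%:E * p w)).
  move=> mH; apply: (measurableT_comp (@measurable_expeR R)).
  apply: emeasurable_funB; first exact: measurableT_comp.
  exact: emeasurable_funM.
set I := \int[Q]_w _.
have key m e : (0 < e)%R ->
    (expR (- e))%:E * expeR (- (\int[P]_w a m w + ph%:E)) <=
    I + Q [set w | e%:E <= `|J_ m w - J w|].
  move=> e0; have [n [t [f [Aat aeJ]]]] := at_ m.
  have lb := atomic_laplace_ge gamma_gt0 beta_gt0 hX k0 r0 rT Aat aeJ.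
  apply: (@le_trans _ _
    ((expR (- e))%:E * \int[Q]_w expeR (- J_ m w - k%:E * p w))).
    by apply: lee_wpmul2l => //; rewrite lee_fin expR_ge0.
  have mD : measurable [set w | e%:E <= `|J_ m w - J w|].
    rewrite -[X in measurable X]setTI; apply: emeasurable_fun_c_infty => //.
    by apply: measurableT_comp => //; exact: emeasurable_funB.
  rewrite -ge0_integralZl_EFin ?expR_ge0//; last 2 first.
  - by move=> w _; exact: expeR_ge0.
  - exact: mkp.
  have -> : Q [set w | e%:E <= `|J_ m w - J w|] =
      \int[Q]_w (\1_[set w | (e%:E <= `|J_ m w - J w|)%E] w)%:E.
    by rewrite integral_indic// setIT.
  rewrite /I -ge0_integralD//; last 3 first.
  - by move=> w _; exact: expeR_ge0.
  - by apply: mkp; exact: measurableT_comp.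
  - exact/measurable_EFinP/measurable_indic.
  apply: le_ge0_integral_ae.
  - by apply: emeasurable_funM => //; exact: mkp.
  - by move=> w; rewrite mule_ge0 ?lee_fin ?expR_ge0 ?expeR_ge0.
  - by move=> w; rewrite adde_ge0 ?expeR_ge0 ?lee_fin.
  apply: filterS aeJ => w Jw.
  have [t0 _ bf _] := Aat.
  have Jf : J_ m w \is a fin_num by rewrite Jw pairing_sum_fin_num.
  have J0 : (0 <= fine (J_ m w))%R.
    rewrite fine_ge0// Jw; apply: sume_ge0 => i _; apply: pairing_ge0.
    by case: (bf i).
  have kp0 : (0 <= k * fine (p w))%R by rewrite mulr_ge0// fine_ge0.
  have := expeR_shift_indic (J w) J0 kp0 e0.
  by rewrite EFinM !fineK.
(* The error is [e / 3] in probability and [2 * (e / 3)] from [expR_shift_le]. *)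
apply/lee_addgt0Pr => e e0.
have e3 : (0 < e / 3)%R by rewrite divr_gt0.
rewrite G1E in cI.
have [fa ca] := (fine_cvgP _ _).1 cI.
pose q m := Q [set w | (e / 3)%:E <= `|J_ m w - J w|].
have [fD cD] : (\forall m \near \oo, q m \is a fin_num) /\
    (fine \o q) m @[m --> \oo] --> 0%R.
  by apply/fine_cvgP; exact: cvP.
have G1lt : (G1 < G1 + e / 3)%R by rewrite ltrDl.
have /filter_ex[m [[fam fDm] [am Dm]]] : \forall m \near \oo,
    (\int[P]_w a m w \is a fin_num /\
     q m \is a fin_num) /\
    ((fine (\int[P]_w a m w) < G1 + e / 3)%R /\
     (fine (q m) < e / 3)%R).
  near=> m; split; split; near: m => //.
  - exact: (cvgr_lt _ ca _ G1lt).
  - exact: (cvgr_lt _ cD _ e3).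
have := key m _ e3; rewrite -/(q m).
rewrite -(fineK fam) -(fineK fDm) -EFinD => h.
apply: (@le_trans _ _ (((expR (- (e / 3)))%:E *
   expeR (- (fine (\int[P]_w a m w) + ph)%:E)) + (2 * (e / 3))%:E)).
  rewrite -EFinN /= -EFinM -EFinD lee_fin -lerBlDr.
  apply: expR_shift_le => //; first by rewrite addr_ge0.
  by rewrite addrAC lerD2r ltW.
apply: (@le_trans _ _ (I + (fine (q m))%:E + (2 * (e / 3))%:E)).
  by rewrite leeD2r.
rewrite -addeA leeD2l// -EFinD lee_fin; lra.
Unshelve. all: by end_near. Qed.
End limits_of_atomic_functionals.

Section J_functionals.
Context (R : realType) (S : ptopologicalType) (Z : markov_process R (borel S)).
Variables (gamma beta : R).
Hypotheses (gamma_gt0 : (0 < gamma)%R) (beta_gt0 : (0 < beta)%R).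
Context (X : markov_process R (finmeas (borel S) R)).
Hypothesis hX : superprocess Z gamma beta X.

Let p (T : R) (w : sample X) : \bar R := pairing (cst 1%R) (X T w).

Let b1 : bounded_pos_measurable (cst 1%R : borel S -> R).
Proof. exact: bounded_pos_measurable_cst. Qed.

Lemma total_mass_fin_num T w : p T w \is a fin_num.
Proof. exact: pairing_fin_num. Qed.

Lemma total_mass_ge0 T w : 0 <= p T w.
Proof. exact: pairing_ge0. Qed.

Lemma measurable_total_mass T : (0 <= T)%R -> measurable_fun setT (p T).
Proof.
by move=> T0; exact: (measurableT_comp (measurable_pairing b1) (measurable_coord T0)).
Qed.

Lemma measurable_expeR_functional k T (J : sample X -> \bar R) : (0 <= T)%R ->
  measurable_fun setT J ->
  measurable_fun setT (fun w => expeR (- J w - k%:E * p T w)).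
Proof.
move=> T0 mJ; apply: (measurableT_comp (@measurable_expeR R)).
apply: emeasurable_funB; first exact: measurableT_comp.
by apply: emeasurable_funM => //; exact: measurable_total_mass.
Qed.

Lemma expeR_functional_le1 k T (x : \bar R) w : (0 <= k)%R ->
  `|expeR (- `|x| - k%:E * p T w)| <= 1.
Proof.
move=> k0; rewrite gee0_abs ?expeR_ge0// -expeR0 lee_expeR.
rewrite -oppeD; last by rewrite fin_num_adde_defl// fin_numM// total_mass_fin_num.
by rewrite oppe_le0 adde_ge0// mule_ge0// total_mass_ge0.
Qed.

(** Almost surely the approximations give no more mass to the half line from [r]
    than [A] gives to the interval from [r] to [T], so they share one lower
    bound, which survives dominated convergence. *)
Lemma Jversion_laplace_ge (k T r : R) (z : borel S)
    (A : sample Z -> {measure set R -> \bar R}) (J : sample X -> \bar R) :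
  (0 <= k)%R -> (0 <= r)%R -> (r <= T)%R ->
  {ae law Z r z, forall w, A w `]T, +oo[%classic = 0} ->
  Jversion r (\d_z : finmeas (borel S) R) A J ->
  expeR (- (\int[law Z r z]_w A w `[r, T]%classic +
            (mass_exponent gamma beta k (T - r))%:E)) <=
  \int[law X r (\d_z : finmeas (borel S) R)]_w
     expeR (- `|J w| - k%:E * p T w).
Proof.
move=> k0 r0 rT AT [mJ _ [A_ [J_ [[_ monoA] J2 cJ]]]].
have T0 := le_trans r0 rT.
set Q := law X r _.
have mJ_ n : measurable_fun setT (J_ n) by have [] := J2 n.
have bnd n : expeR (- (\int[law Z r z]_w A w `[r, T]%classic +
            (mass_exponent gamma beta k (T - r))%:E)) <=
    \int[Q]_w expeR (- `|J_ n w| - k%:E * p T w).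
  apply: (Jversion2_laplace_ge gamma_gt0 beta_gt0 hX k0 r0 rT (J2 n)) => //.
  apply: filterS AT => w AT0.
  have rsub := subset_itvcy0 r0.
  have [nd cv] := monoA w `[r, +oo[%classic (measurable_itv _) rsub.
  apply: (@le_trans _ _ (A w `[r, +oo[%classic)).
    rewrite (cvg_unique _ cv (ereal_nondecreasing_cvgn nd))//.
    by apply: ereal_sup_ubound; exists n.
  apply: (@le_trans _ _ (A w (`[r, T]%classic `|` `]T, +oo[%classic))).
    apply: le_measure; rewrite ?inE; [exact: measurable_itv|exact: measurableU|].
    move=> x /=; rewrite !in_itv/= !andbT => rx.
    by have [xT|Tx] := leP x T; [left; rewrite rx|right].
  apply: (le_trans (measureU2 _ _ _)) => //; try exact: measurable_itv.
  have AT0' : A w `]T, +oo[%classic <= 0 by rewrite AT0.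
  by rewrite -[leRHS]adde0; exact: leeD (lexx _) AT0'.
have [_ _ cI] : [/\ Q.-integrable setT (fun w => expeR (- `|J w| - k%:E * p T w)),
    \int[Q]_w `|expeR (- `|J_ n w| - k%:E * p T w) -
       expeR (- `|J w| - k%:E * p T w)| @[n --> \oo] --> 0 &
    \int[Q]_w expeR (- `|J_ n w| - k%:E * p T w) @[n --> \oo] -->
       \int[Q]_w expeR (- `|J w| - k%:E * p T w)].
  apply: (@dominated_convergence _ _ _ Q setT measurableT _ _ (cst 1%:E)) => //.
  - by move=> n; apply: measurable_expeR_functional => //; exact: measurableT_comp.
  - by apply: measurable_expeR_functional => //; exact: measurableT_comp.
  - apply: filterS cJ => w cw _; apply: cvg_expeR; apply: cvgeB.
    + by rewrite fin_num_adde_defl// fin_numN fin_numM// total_mass_fin_num.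
    + by apply: cvgeN; exact: cvg_abse.
    + exact: cvg_cst.
  - exact: integrable_cst_law.
  - by apply: aeW => w n _; exact: expeR_functional_le1.
by apply: (cvge_to_ge cI); exact: nearW.
Qed.

(** Letting k tend to infinity turns [expeR (- k%:E * p T w)] into the indicator
    of extinction, while [mass_exponent_le_inv] bounds the exponents uniformly
    in k. *)
Lemma Jversion_extinction_ge (T r : R) (z : borel S)
    (A : sample Z -> {measure set R -> \bar R}) (J : sample X -> \bar R) :
  (0 <= r)%R -> (r < T)%R ->
  {ae law Z r z, forall w, A w `]T, +oo[%classic = 0} ->
  Jversion r (\d_z : finmeas (borel S) R) A J ->
  expeR (- (\int[law Z r z]_w A w `[r, T]%classic +
            (1 / (gamma * beta * (T - r)) `^ (1 / beta))%:E)) <=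
  \int[law X r (\d_z : finmeas (borel S) R)]_w
     (expeR (- `|J w|) * (\1_[set w' | zero_measure (X T w')] w)%:E).
Proof.
move=> r0 rT AT hJ; have T0 := le_trans r0 (ltW rT).
have mJ : measurable_fun setT J by have [] := hJ.
set Q := law X r _.
pose F n w := expeR (- `|J w| - (n%:R)%:E * p T w).
pose L w := expeR (- `|J w|) * (\1_[set w' | zero_measure (X T w')] w)%:E.
have cF w : F n w @[n --> \oo] --> L w.
  rewrite /L indicE; have [zX|nzX] := pselect (zero_measure (X T w)).
    rewrite mem_set// mule1 (_ : F ^~ w = cst (expeR (- `|J w|))).
      exact: cvg_cst.
    apply/funext => n; rewrite /F /p (pairing_zero _ zX) mule0.
    by rewrite oppe0 adde0.
  rewrite memNset// mule0 -[0]/(expeR -oo); apply: cvg_expeR.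
  have p_gt0 : (0 < fine (p T w))%R.
    rewrite fine_gt0// ltey_eq total_mass_fin_num/= andbT lt_neqAle total_mass_ge0 andbT.
    by apply/eqP => /esym p0; apply: nzX; apply/zero_measureP.
  apply/cvgeNyPle => B.
  exists (Num.truncn (- B / fine (p T w))).+1 => // n /= Bn.
  apply: (@le_trans _ _ (- (n%:R%:E * p T w))).
    by rewrite -[leRHS]add0e leeD2r// oppe_le0.
  rewrite -(fineK (total_mass_fin_num T w)) -EFinM -EFinN lee_fin.
  rewrite lerNl -ler_pdivrMr// (le_trans (ltW (truncnS_gt _)))// ler_nat.
  exact: Bn.
have mF n : measurable_fun setT (F n).
  by apply: measurable_expeR_functional => //; exact: measurableT_comp.
have [_ _ cI] : [/\ Q.-integrable setT L,
    \int[Q]_w `|F n w - L w| @[n --> \oo] --> 0 &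
    \int[Q]_w F n w @[n --> \oo] --> \int[Q]_w L w].
  apply: (@dominated_convergence _ _ _ Q setT measurableT F L (cst 1%:E)) => //.
  - exact: (emeasurable_fun_cvg _ _ mF (fun w _ => cF w)).
  - by apply: aeW => w _; exact: cF.
  - exact: integrable_cst_law.
  - by apply: aeW => w n _; exact: expeR_functional_le1.
apply: (cvge_to_ge cI); apply: nearW => n.
apply: le_trans (Jversion_laplace_ge (ler0n _ n) r0 (ltW rT) AT hJ).
rewrite lee_expeR leeN2 leeD2l// lee_fin.
by apply: mass_exponent_le_inv => //; rewrite subr_gt0.
Qed.

End J_functionals.

Lemma oppe_lne_le (R : realType) (x y : \bar R) : 0 <= x ->
  expeR (- y) <= x -> - lne x <= y.
Proof.
move=> x0 yx; rewrite leeNl -[leLHS]expeRK lee_lne//.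
- by rewrite in_itv/= expeR_ge0 leey.
- by rewrite in_itv/= x0 leey.
Qed.

Theorem proposition3p5 (R : realType) (S : ptopologicalType)
    (hS : metrizable_luzin R S)
    (Z : markov_process R (borel S)) (hZ : right_process Z)
    (T gamma beta : R) (hT : (0 < T)%R) (hgamma : (0 < gamma)%R)
    (hbeta : (0 < beta <= 1)%R)
    (X : markov_process R (finmeas (borel S) R))
    (hX : superprocess Z gamma beta X)
    (A : sample Z -> {measure set R -> \bar R}) (hA : classA1 T A)
    (r : R) (hr : (0 <= r < T)%R) (z : S)
    (J : sample X -> \bar R)
    (hJ : Jversion r (\d_(z : borel S)) A J) :
  (forall k : R, (0 <= k)%R ->
     - lne (\int[law X r (\d_(z : borel S))]_w
              expeR (- J w - k%:E * pairing (cst 1%R) (X T w)))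
     <= \int[law Z r z]_w A w `[r, T]%classic +
        (k / (1 + gamma * beta * (T - r) * k `^ beta) `^ (1 / beta))%:E)
  /\
  - lne (\int[law X r (\d_(z : borel S))]_w
           (expeR (- J w) * (\1_[set w' | zero_measure (X T w')] w)%:E))
  <= \int[law Z r z]_w A w `[r, T]%classic +
     (1 / (gamma * beta * (T - r)) `^ (1 / beta))%:E.
Proof.
have /andP[r0 rT] := hr; have /andP[beta_gt0 _] := hbeta.
have [_ AT] : \int[law Z r z]_w A w `[r, T]%classic < +oo /\
    {ae law Z r z, forall w, A w `]T, +oo[%classic = 0}.
  by apply: hA.2; rewrite r0 ltW.
have leJ w : - `|J w| <= - J w by rewrite leeN2 lee_abs.
split=> [k k0|]; apply: oppe_lne_le.
- by apply: integral_ge0 => w _; exact: expeR_ge0.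
- apply: le_trans (Jversion_laplace_ge hgamma beta_gt0 hX k0 r0 (ltW rT) AT hJ) _.
  apply: le_ge0_integral => w _; first exact: expeR_ge0.
  by rewrite lee_expeR leeD2r.
- by apply: integral_ge0 => w _; rewrite mule_ge0 ?expeR_ge0// lee_fin.
- apply: le_trans (Jversion_extinction_ge hgamma beta_gt0 hX r0 rT AT hJ) _.
  apply: le_ge0_integral => w _; first by rewrite mule_ge0 ?expeR_ge0// lee_fin.
  by apply: lee_wpmul2r; rewrite ?lee_fin// lee_expeR.
Qed.
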